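(* Let $p\ge2$. Let $X, X_1, X_2, \dots$ be a stationary sequence of non-degenerate $\rho$-mixing random variables with common density $f$ (with respect to Lebesgue measure), and let $f_{n,K}(x)=\frac{1}{nh_n}\sum_{i=1}^n K\big(\frac{X_i-x}{h_n}\big)$. Assume that: (i) $\sum_{i=0}^{\infty}\rho^{2/p}(2^i)<\infty$; (ii) the bandwidths $h_n>0$ satisfy $h_n\searrow 0$ and $nh_n\to\infty$ as $n\to\infty$; (iii) $f$ is uniformly bounded on $\mathbb{R}$; (iv) $K:\mathbb{R}\to\mathbb{R}$ is measurable with $\sup_{x\in\mathbb{R}}|K(x)|<\infty$ and $\int_{-\infty}^{\infty}|K(x)|\,dx<\infty$. Then $$\sup_{x\in\mathbb{R}}\big\|f_{n,K}(x)-Ef_{n,K}(x)\big\|_p=O\Big[\Big(\frac{1}{nh_n}\Big)^{1/2}\Big]\quad\text{as } n\to\infty.$$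
   Context: $\rho$-mixing: for a sequence $X_1,X_2,\dots$ of random variables on a probability space, put $\mathscr{F}_n^-=\sigma(X_i,1\le i\le n)$, $\mathscr{F}_n^+=\sigma(X_i,i\ge n)$ and $$\rho(n)=\sup_{k\ge1}\ \sup_{X\in L^2(\mathscr{F}_k^-)}\ \sup_{Y\in L^2(\mathscr{F}_{k+n}^+)}\frac{|EXY-EXEY|}{\sqrt{E(X-EX)^2E(Y-EY)^2}}.$$ The sequence is $\rho$-mixing if $\rho(n)\to0$ as $n\to\infty$. For a random variable $Y$, $\|Y\|_p=(E|Y|^p)^{1/p}$; $a_n=O(b_n)$ means $\limsup_{n\to\infty}a_n/b_n<\infty$. *)

(* Defs.v *)
From mathcomp Require Import all_boot all_order all_algebra.
From mathcomp Require Import all_classical all_reals all_analysis.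
Set Implicit Arguments.
Unset Strict Implicit.
Unset Printing Implicit Defensive.
Import Order.TTheory GRing.Theory Num.Theory.
Import numFieldNormedType.Exports.
Local Open Scope classical_set_scope.
Local Open Scope ring_scope.

(* A sequence X_1, X_2, ... is given by X : nat -> T -> R (or a family of random
   variables indexed by nat); X 0 is never used. *)
Section mixing.
Context d (T : measurableType d) (R : realType) (P : probability T R).

Definition sigma_gen (X : nat -> T -> R) (I : set nat) : set (set T) :=
  <<s \bigcup_(i in I) preimage_set_system setT (X i) measurable >>.

Definition past (X : nat -> T -> R) (n : nat) : set (set T) :=
  sigma_gen X [set i | (1 <= i <= n)%N].

Definition future (X : nat -> T -> R) (n : nat) : set (set T) :=
  sigma_gen X [set i | (n <= i)%N].

Definition L2 (G : set (set T)) : set (T -> R) :=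
  [set Y | preimage_set_system setT Y measurable `<=` G /\
           Y \in Lfun P 2%:E].

(* For degenerate Y or Z both the numerator and, since x / 0 = 0, the quotient
   are 0, so such pairs do not affect the supremum below. *)
Definition abs_corr (Y Z : T -> R) : R :=
  `| fine 'E_P[Y \* Z] - fine 'E_P[Y] * fine 'E_P[Z] | /
  Num.sqrt (fine 'V_P[Y] * fine 'V_P[Z]).

Definition rho (X : nat -> T -> R) (n : nat) : \bar R :=
  ereal_sup [set r : \bar R | exists k, (1 <= k)%N /\
    exists Y Z : T -> R, [/\ L2 (past X k) Y, L2 (future X (k + n)) Z &
                            r = (abs_corr Y Z)%:E]].

Definition rho_mixing (X : nat -> T -> R) : Prop :=
  rho X n @[n --> \oo] --> 0%E.

(* Strict stationarity: (X_1, ..., X_n) and (X_{m+1}, ..., X_{m+n}) have the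
   same law for all m and n. *)
Definition stationary (X : nat -> T -> R) : Prop :=
  forall (m n : nat) (B : set (n.-tuple R)), measurable B ->
    P [set w | B [tuple X i.+1 w | i < n]] =
    P [set w | B [tuple X (m + i.+1)%N w | i < n]].

Definition nondegenerate_rv (Y : T -> R) : Prop :=
  forall c : R, ~ {ae P, forall w, Y w = c}.

Definition has_density (Y : {RV P >-> R}) (f : R -> R) : Prop :=
  [/\ measurable_fun setT f, forall x, 0 <= f x &
      forall A : set R, measurable A ->
        distribution P Y A = (\int[lebesgue_measure]_(x in A) (f x)%:E)%E].

Definition kernel_est (X : nat -> T -> R) (h : nat -> R) (K : R -> R)
    (n : nat) (x : R) : T -> R :=
  fun w => (n%:R * h n)^-1 * \sum_(1 <= i < n.+1) K ((X i w - x) / h n).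

End mixing.

(* a_n = O(b_n), with a_n possibly infinite a priori; the sequences of interest
   have b_n > 0 for n >= 1, and the value at n = 0 does not matter. *)
Definition bigO_seq (R : realType) (a : nat -> \bar R) (b : nat -> R) : Prop :=
  (limn_esup (fun n => a n / (b n)%:E) < +oo)%E.

(* Main.v *)
From HB Require Import structures.
Require Import Defs.
From mathcomp Require Import all_boot all_order all_algebra.
From mathcomp Require Import all_classical all_reals all_analysis.
From mathcomp Require Import measurable_realfun.
From mathcomp Require Import zify ring lra.
Set Implicit Arguments.
Unset Strict Implicit.
Unset Printing Implicit Defensive.
Import Order.TTheory GRing.Theory Num.Theory.
Import numFieldNormedType.Exports.
Local Open Scope classical_set_scope.
Local Open Scope ring_scope.

(* The estimator minus its mean is [(n h)^-1] times a sum of [n] centered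
   variables [Y_i = psi_i (X_i)] that are bounded by a constant and have second
   moment at most [v = c h], because [f] is bounded. It is thus enough to have a
   Rosenthal inequality
     [E |Y_j + ... + Y_(j+m-1)| ^ q <= D (s ^ (q/2) + s)],
   [s = 2 ^ N v], [m <= 2 ^ N], with [D] independent of [psi], [v] and [j]: for
   [q = p] and [2 ^ N ~ n] one has [s >= 1] as soon as [n h >= 1].
   It is proved by doubling the length of the blocks: a block of length
   [2 ^ (k+1)] is split into two blocks [A], [B] of length at most [2 ^ k],
   separated by a gap of length [2 ^ (k / L)] whose contribution is negligible.
   - For [q = 2], [|E A B| <= rho (E A^2 E B^2)^(1/2)].
   - For [q = 2 r > 2],
       [|A + B|^q <= (1 + C t) (|A|^q + |B|^q) + C t^(1-r) |A|^r |B|^r]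
     for all [t > 0]; mixing applied to [|A|^r] and [|B|^r] replaces
     [E |A|^r |B|^r] by [E |A|^r E |B|^r], which is known by induction on [q], up
     to [rho E|A|^q]. Taking [t] at least [rho ^ (1/r) = rho ^ (2/q)] makes
     [t^(1-r) rho <= t], so the relative error is summable over the scales. *)

(** * Inequalities for real powers and sums *)

Section real_inequalities.
Context {R : realType}.
Implicit Types a b q r s x t : R.

(** Chosen as a power of 3 with an integer exponent at least [q], so that [powR1D_le] can be proved
    by induction on that exponent. *)
Definition pow_cst q : R := 3 ^+ (Num.bound q).

Lemma pow_cst_ge1 q : 1 <= pow_cst q.
Proof. by rewrite /pow_cst exprn_ege1// ler1n. Qed.

(** After raising the exponent to an integer, each induction step is
    [(1 + s) (1 + c s) <= 1 + 3 c s], which follows from [s ^ 2 <= s] and [c >= 1]. *)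
Lemma powR1D_le q s : 0 <= q -> 0 <= s <= 1 -> (1 + s) `^ q <= 1 + pow_cst q * s.
Proof.
move=> q0 /andP[s0 s1].
have le1s : 1 <= 1 + s by rewrite lerDl.
apply: (@le_trans _ _ ((1 + s) `^ (Num.bound q)%:R)).
  by apply: ler_powR => //; rewrite ltW// archi_boundP.
rewrite powR_mulrn ?addr_ge0// /pow_cst.
elim: (Num.bound q) => [|m IH]; first by rewrite !expr0 mul1r.
have m1 : 1 <= 3 ^+ m :> R by rewrite exprn_ege1// ler1n.
rewrite !exprS; apply: (le_trans (ler_wpM2l _ IH)); first exact: addr_ge0.
have : s * s <= s by rewrite ler_piMr.
have : s <= 3 ^+ m * s by rewrite ler_peMl.
set c := 3 ^+ m => *; nra.
Qed.

(** Either [|b| <= t |a|], and [|a + b| <= (1 + t) |a|], or [|a| < |b| / t], and [|a + b| <= (1 + 1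
    / t) |b| <= (2 / t) |b|]. This detaches a gap [b] from the main part [a] at a relative cost of
    order [t]. *)
Lemma powR_normD_gap q t a b : 0 <= q -> 0 < t <= 1 ->
  `|a + b| `^ q <= (1 + pow_cst q * t) * `|a| `^ q + (2 / t) `^ q * `|b| `^ q.
Proof.
move=> q0 /andP[t0 t1].
have C1 := pow_cst_ge1 q.
have C0 : 0 <= pow_cst q by exact: le_trans C1.
have [le_ba|lt_ab] := leP `|b| (t * `|a|).
- apply: (@le_trans _ _ ((1 + pow_cst q * t) * `|a| `^ q)); last first.
    by rewrite lerDl mulr_ge0 ?powR_ge0.
  apply: (@le_trans _ _ (((1 + t) * `|a|) `^ q)).
    rewrite ge0_ler_powR ?nnegrE// ?mulr_ge0 ?addr_ge0 ?(ltW t0)//.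
    by rewrite (le_trans (ler_normD _ _))// mulrDl mul1r lerD2l.
  rewrite powRM ?addr_ge0 ?(ltW t0)// ler_wpM2r ?powR_ge0// powR1D_le//.
  by rewrite (ltW t0).
- apply: (@le_trans _ _ ((2 / t) `^ q * `|b| `^ q)); last first.
    by rewrite lerDr mulr_ge0 ?powR_ge0 ?addr_ge0 ?mulr_ge0 ?(ltW t0).
  rewrite -powRM ?mulr_ge0 ?invr_ge0 ?(ltW t0)//.
  rewrite ge0_ler_powR ?nnegrE ?mulr_ge0 ?invr_ge0 ?(ltW t0)//.
  rewrite (le_trans (ler_normD _ _))// mulrAC ler_pdivlMr// mulrDl.
  have := normr_ge0 b; have := normr_ge0 a; nra.
Qed.

(** Let [|b| <= |a|] and [s = |b| / |a|], so that the left side is at most [|a| ^ (2 r) (1 + C s)].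
    If [s <= t], the error [C s] is at most [C t]. If [s > t], then [(s / t) ^ (r - 1) >= 1] gives
    [s <= t ^ (1 - r) s ^ r], and [|a| ^ (2 r) s ^ r] is the product [|a| ^ r |b| ^ r]. *)
Lemma powR_normD_prod r t a b : 1 <= r -> 0 < t ->
  `|a + b| `^ (2 * r) <=
  (1 + pow_cst (2 * r) * t) * (`|a| `^ (2 * r) + `|b| `^ (2 * r)) +
  pow_cst (2 * r) * t `^ (1 - r) * (`|a| `^ r * `|b| `^ r).
Proof.
move=> r1 t0; have C1 := pow_cst_ge1 (2 * r); set C := pow_cst _ in C1 *.
have C0 : 0 <= C by exact: le_trans C1.
have r0 : 0 <= r by exact: le_trans r1.
have q0 : 0 <= 2 * r by rewrite mulr_ge0.
wlog ab : a b / `|b| <= `|a|.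
  move=> H; have [/H//|/ltW/H] := leP `|b| `|a|.
  by rewrite (addrC b a) (addrC (`|b| `^ _)) (mulrC (`|b| `^ r)).
have [a0|a0] := eqVneq a 0.
  move: ab; rewrite a0 normr0 normr_le0 => /eqP ->.
  by rewrite addr0 normr0 powR0 ?addr0 ?mulr0 ?add0r ?mulr_ge0 ?powR_ge0 //
     gt_eqF// mulr_gt0// (lt_le_trans _ r1).
have na0 : 0 < `|a| by rewrite normr_gt0.
pose s := `|b| / `|a|.
have s0 : 0 <= s by rewrite divr_ge0.
have s1 : s <= 1 by rewrite ler_pdivrMr// mul1r.
have bE : `|b| = `|a| * s by rewrite /s mulrC divfK// gt_eqF.
have aq := powR_ge0 `|a| (2 * r).
have bq := powR_ge0 `|b| (2 * r).
apply: (@le_trans _ _ (`|a| `^ (2 * r) * (1 + C * s))).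
  apply: (@le_trans _ _ ((`|a| * (1 + s)) `^ (2 * r))).
    apply: ge0_ler_powR; rewrite ?nnegrE ?mulr_ge0 ?addr_ge0//.
    by rewrite mulrDr mulr1 -bE ler_normD.
  by rewrite powRM ?addr_ge0// ler_wpM2l// powR1D_le// s0.
have [st|ts] := leP s t.
  have h1 : `|a| `^ (2 * r) * (1 + C * s) <= `|a| `^ (2 * r) * (1 + C * t).
    by rewrite ler_wpM2l// lerD2l ler_wpM2l.
  apply: (le_trans h1); rewrite [in leRHS]mulrDr -addrA [leLHS]mulrC lerDl.
  rewrite addr_ge0//; first by rewrite mulr_ge0// addr_ge0// mulr_ge0// ltW.
  by rewrite !mulr_ge0 ?powR_ge0.
have sp : 0 < s by exact: lt_trans ts.
have key : s <= t `^ (1 - r) * s `^ r.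
  rewrite -[leLHS]powRr1// -{1}(subrK r 1) powRD; last first.
    by apply/implyP => _; rewrite gt_eqF.
  rewrite ler_wpM2r ?powR_ge0// -opprB !powRN lef_pV2 ?posrE ?powR_gt0//.
  by rewrite ge0_ler_powR ?nnegrE ?subr_ge0 ?(ltW t0)// ltW.
have prodE : `|a| `^ r * `|b| `^ r = `|a| `^ (2 * r) * s `^ r.
  rewrite bE powRM// mulrA -powRD ?(gt_eqF na0) ?implybT//.
  by congr (_ `^ _ * _); ring.
rewrite mulrDr mulr1 prodE.
have h2 : `|a| `^ (2 * r) * (C * s) <=
    C * t `^ (1 - r) * (`|a| `^ (2 * r) * s `^ r).
  have -> : C * t `^ (1 - r) * (`|a| `^ (2 * r) * s `^ r) =
    `|a| `^ (2 * r) * (C * (t `^ (1 - r) * s `^ r)) by ring.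
  by rewrite ler_wpM2l// ler_wpM2l.
apply: lerD => //.
have Ct : 0 <= C * t by rewrite mulr_ge0// ltW.
nra.
Qed.

(** Integrated with [s] of the order of the second moment, this bounds a moment of order [r <= 2],
    in place of Jensen's inequality. For [x ^ 2 > s] it holds because the exponent [r / 2 - 1] is
    nonpositive. *)
Lemma powR_norm_le_sqr r s x : 0 <= r <= 2 -> 0 < s ->
  `|x| `^ r <= s `^ (r / 2) + s `^ (r / 2 - 1) * x ^+ 2.
Proof.
move=> /andP[r0 r2] s0.
have [xs|sx] := leP (x ^+ 2) s.
  apply: (@le_trans _ _ (s `^ (r / 2))); last first.
    by rewrite lerDl mulr_ge0 ?powR_ge0 ?sqr_ge0.
  have -> : `|x| `^ r = (x ^+ 2) `^ (r / 2).
    rewrite -(real_normK (num_real x)) -powR_mulrn// -powRrM.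
    by congr (_ `^ _); field.
  by rewrite ge0_ler_powR ?nnegrE ?divr_ge0 ?sqr_ge0 ?(ltW s0).
have x0 : 0 < x ^+ 2 by exact: lt_trans sx.
apply: (@le_trans _ _ (s `^ (r / 2 - 1) * x ^+ 2)); last first.
  by rewrite lerDr powR_ge0.
have -> : `|x| `^ r = (x ^+ 2) `^ (r / 2 - 1) * (x ^+ 2).
  have -> : `|x| `^ r = (x ^+ 2) `^ (r / 2).
    rewrite -(real_normK (num_real x)) -powR_mulrn// -powRrM.
    by congr (_ `^ _); field.
  rewrite -[in X in _ = _ * X](@powRr1 _ (x ^+ 2)) ?ltW//.
  by rewrite -powRD ?(gt_eqF x0) ?implybT// subrK.
rewrite ler_wpM2r ?(ltW x0)// -opprB !powRN lef_pV2 ?posrE ?powR_gt0//.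
rewrite ge0_ler_powR ?nnegrE ?(ltW s0) ?(ltW x0) ?(ltW sx)//.
by rewrite subr_ge0 ler_pdivrMr// mul1r.
Qed.

End real_inequalities.

Section sums.
Context {R : realType}.
Implicit Types (w : nat -> R) (x : R).

(** Each value [w i] is repeated at most [L] times. The gap at scale [k] has length [2 ^ (k / L)],
    hence the mixing coefficients enter the sum over scales in this slowed form. *)
Lemma sum_divn_le w W L N : (0 < L)%N -> (forall i, 0 <= w i) ->
  (forall n, \sum_(i < n) w i <= W) ->
  \sum_(k < N) w (k %/ L)%N <= L%:R * W.
Proof.
move=> L0 w0 wW.
have E n : \sum_(k < n * L) w (k %/ L)%N = L%:R * \sum_(i < n) w i.
  elim: n => [|n IH]; first by rewrite mul0n !big_ord0 mulr0.
  rewrite big_ord_recr mulrDr -IH /= mulSn addnC.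
  rewrite -(big_mkord xpredT (fun k => w (k %/ L)%N)).
  rewrite (@big_cat_nat _ _ _ (n * L))//= ?leq_addr// big_mkord; congr +%R.
  rewrite -[X in \sum_(X <= _ < _) _]add0n big_addn addKn.
  rewrite big_mkord (eq_bigr (fun=> w n)); last first.
    by move=> i _; rewrite addnC divnMDl// divn_small// addn0.
  by rewrite sumr_const card_ord mulr_natl.
apply: (@le_trans _ _ (\sum_(k < N * L) w (k %/ L)%N)); last first.
  by rewrite E ler_wpM2l.
rewrite -(big_mkord xpredT (fun k => w (k %/ L)%N)).
rewrite -(big_mkord xpredT (fun k => w (k %/ L)%N)).
rewrite [leRHS](@big_cat_nat _ _ _ N)//= ?leq_pmulr// lerDl.
exact: sumr_ge0.
Qed.

Lemma sum_geo_le x N : 0 <= x < 1 -> \sum_(k < N) x ^+ k <= (1 - x)^-1.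
Proof.
move=> /andP[x0 x1]; have d0 : 0 < 1 - x by rewrite subr_gt0.
rewrite -[leRHS]mul1r ler_pdivlMr//.
rewrite mulrC -opprB mulNr -subrX1 opprB lerBlDr lerDl.
exact: exprn_ge0.
Qed.

Lemma sum_geo_rev_le x N : 0 <= x < 1 -> \sum_(k < N) x ^+ (N - k) <= (1 - x)^-1.
Proof.
move=> x01; apply: le_trans (sum_geo_le N x01).
have /andP[x0 x1] := x01.
rewrite (reindex_inj rev_ord_inj) /=; apply: ler_sum => k _.
rewrite subKn// exprS ler_piMl ?exprn_ge0// ltW//.
Qed.

(** A discrete Gronwall inequality. It speaks of a predicate [Q k b], read as [b] being a bound at
    scale [k], so that it applies to bounds uniform over all blocks of a scale. *)
Lemma gronwall_pred (Q : nat -> R -> Prop) (t e : nat -> R) (b0 : R) (N : nat) :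
  (forall k a b, a <= b -> Q k a -> Q k b) ->
  (forall k, 0 <= t k) -> (forall k, 0 <= e k) ->
  Q 0 b0 -> 0 <= b0 ->
  (forall k b, (k < N)%N -> 0 <= b -> Q k b -> Q k.+1 (expR (t k) * (b + e k))) ->
  Q N (expR (\sum_(k < N) t k) * (b0 + \sum_(k < N) e k)).
Proof.
move=> Qmon t0 e0 Q0 b00 Qstep.
suff : forall k, (k <= N)%N ->
    Q k (expR (\sum_(i < k) t i) * (b0 + \sum_(i < k) e i)) by apply.
elim=> [_|k IH kN]; first by rewrite !big_ord0 expR0 addr0 mul1r.
have {IH} := IH (ltnW kN).
set A := \sum_(i < k) t i; set B := \sum_(i < k) e i => IH.
have B0 : 0 <= b0 + B by rewrite addr_ge0// sumr_ge0.
apply: Qmon (Qstep _ _ kN _ IH); last by rewrite mulr_ge0 ?expR_ge0.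
rewrite !big_ord_recr /= -/A -/B expRD addrA [X in _ <= X * _]mulrC -mulrA.
rewrite ler_wpM2l ?expR_ge0// [leRHS]mulrDr lerD2l ler_peMl//.
by rewrite -expR0 ler_expR sumr_ge0.
Qed.

End sums.

(** * Expectations of bounded random variables *)

Section bounded_measurable.
Context d (T : measurableType d) (R : realType).
Implicit Types Y Z : T -> R.

Definition bounded_mfun Y :=
  measurable_fun setT Y /\ exists M : R, forall w, `|Y w| <= M.

Lemma bounded_mfun_cst (c : R) : bounded_mfun (fun=> c).
Proof. by split; [exact: measurable_cst|exists `|c|]. Qed.

Lemma bounded_mfunD Y Z : bounded_mfun Y -> bounded_mfun Z ->
  bounded_mfun (fun w => Y w + Z w).
Proof.
move=> [mY [M YM]] [mZ [N ZN]]; split; first exact: measurable_funD.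
by exists (M + N) => w; rewrite (le_trans (ler_normD _ _))// lerD.
Qed.

Lemma bounded_mfunM Y Z : bounded_mfun Y -> bounded_mfun Z ->
  bounded_mfun (fun w => Y w * Z w).
Proof.
move=> [mY [M YM]] [mZ [N ZN]]; split; first exact: measurable_funM.
by exists (M * N) => w; rewrite normrM ler_pM.
Qed.

Lemma bounded_mfunZ (c : R) Y : bounded_mfun Y -> bounded_mfun (fun w => c * Y w).
Proof. by apply: bounded_mfunM; exact: bounded_mfun_cst. Qed.

Lemma bounded_mfunX Y n : bounded_mfun Y -> bounded_mfun (fun w => Y w ^+ n).
Proof.
move=> bY; elim: n => [|n IH]; first exact: bounded_mfun_cst.
rewrite (_ : (fun w => _) = fun w => Y w * Y w ^+ n); first exact: bounded_mfunM.
by apply/funext => w; rewrite exprS.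
Qed.

Lemma bounded_mfun_sum n (F : nat -> T -> R) :
  (forall i, bounded_mfun (F i)) -> bounded_mfun (fun w => \sum_(i < n) F i w).
Proof.
move=> bF; elim: n => [|n IH].
  under eq_fun do rewrite big_ord0.
  exact: bounded_mfun_cst.
under eq_fun do rewrite big_ord_recr.
exact: bounded_mfunD.
Qed.

Lemma bounded_mfun_powR (p : R) Y : 0 <= p -> bounded_mfun Y ->
  bounded_mfun (fun w => `|Y w| `^ p).
Proof.
move=> p0 [mY [M YM]]; split.
  apply: (measurableT_comp (measurable_powR p)).
  exact: measurableT_comp.
exists (M `^ p) => w; rewrite ger0_norm ?powR_ge0//.
by rewrite ge0_ler_powR ?nnegrE// (le_trans _ (YM w)).
Qed.

End bounded_measurable.
#[global] Hint Resolve bounded_mfun_cst : core.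

Section expectation_bounded.
Context d (T : measurableType d) (R : realType) (P : probability T R).
Implicit Types Y Z : T -> R.

Local Notation E Y := (fine 'E_P[Y]).

Lemma bounded_mfun_integrable Y : bounded_mfun Y ->
  P.-integrable setT (EFin \o Y).
Proof.
move=> [mY [M YM]]; apply: measurable_bounded_integrable => //.
  by rewrite (le_lt_trans (probability_le1 _ _))// ltry.
exists M; split; first exact: num_real.
by move=> x Mx w _ /=; rewrite (le_trans (YM w))// ltW.
Qed.

Lemma bounded_mfun_Lfun1 Y : bounded_mfun Y -> Y \in Lfun P 1.
Proof. by move=> bY; apply/Lfun1_integrable/bounded_mfun_integrable. Qed.

Lemma bounded_mfun_Lfun2 Y : bounded_mfun Y -> Y \in Lfun P 2%:E.
Proof.
move=> bY; rewrite inE; apply/andP; split; rewrite inE/=; first exact: bY.1.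
rewrite /finite_norm unlock poweR_lty//.
have := bounded_mfun_integrable (bounded_mfun_powR (ler0n R 2) bY).
move=> /integrableP[_]; apply: le_lt_trans; rewrite le_eqVlt; apply/orP; left.
apply/eqP; apply: eq_integral => w _ /=.
by rewrite (ger0_norm (powR_ge0 _ _)).
Qed.

Lemma expect_cst (c : R) : E (fun=> c) = c.
Proof. by rewrite -[X in ('E_P[X])%E]/(cst c) expectation_cst. Qed.

Lemma expectD Y Z : bounded_mfun Y -> bounded_mfun Z ->
  E (fun w => Y w + Z w) = E Y + E Z.
Proof.
move=> /bounded_mfun_Lfun1 bY /bounded_mfun_Lfun1 bZ.
by rewrite -[X in ('E_P[X])%E]/(Y \+ Z) expectationD// fineD// expectation_fin_num.
Qed.

Lemma expectZ (c : R) Y : bounded_mfun Y -> E (fun w => c * Y w) = c * E Y.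
Proof.
move=> /bounded_mfun_Lfun1 bY.
rewrite (_ : (fun w => _) = c \o* Y); last by apply/funext => w /=; rewrite mulrC.
by rewrite expectationZl// fineM// expectation_fin_num.
Qed.

Lemma expect_le Y Z : bounded_mfun Y -> bounded_mfun Z ->
  (forall w, Y w <= Z w) -> E Y <= E Z.
Proof.
move=> bY bZ YZ; rewrite !unlock; apply: le_Rintegral => //;
  exact: bounded_mfun_integrable.
Qed.

Lemma expect_ge0 Y : (forall w, 0 <= Y w) -> 0 <= E Y.
Proof. by move=> Y0; rewrite fine_ge0// expectation_ge0. Qed.

Lemma expect_sqr_sum_le n (F : nat -> T -> R) v :
  (forall i, bounded_mfun (F i)) ->
  (forall i, (i < n)%N -> E (fun w => F i w ^+ 2) <= v) ->
  E (fun w => (\sum_(i < n) F i w) ^+ 2) <= n%:R ^+ 2 * v.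
Proof.
move=> bF; elim: n => [|n IH] Fv.
  under eq_fun do rewrite big_ord0 expr0n.
  by rewrite expect_cst expr0n mul0r.
have [->|n0] := posnP n.
  under eq_fun do rewrite big_ord_recr/= big_ord0 add0r.
  by rewrite expr1n mul1r Fv.
pose S w := \sum_(i < n) F i w.
have bS : bounded_mfun S by exact: bounded_mfun_sum.
have nR0 : 0 < n%:R :> R by rewrite ltr0n.
(* Young's inequality with weight [n]: the right side exceeds [(S + F) ^ 2] by [(S - n F) ^ 2 / n],
   and [(1 + 1 / n) n ^ 2 + (1 + n) = (n + 1) ^ 2]. *)
apply: (@le_trans _ _ (E (fun w =>
  (1 + n%:R^-1) * S w ^+ 2 + (1 + n%:R) * F n w ^+ 2))).
  apply: expect_le.
  - by apply: bounded_mfunX; exact: bounded_mfun_sum.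
  - by apply: bounded_mfunD; apply: bounded_mfunZ; exact: bounded_mfunX.
  - move=> w; rewrite big_ord_recr/= -/(S w).
    rewrite -subr_ge0 [leRHS](_ : _ = n%:R^-1 * (S w - n%:R * F n w) ^+ 2).
      by rewrite mulr_ge0 ?invr_ge0 ?(ltW nR0)// sqr_ge0.
    by field; rewrite gt_eqF.
rewrite expectD; [|by apply: bounded_mfunZ; exact: bounded_mfunX..].
rewrite !expectZ; [|exact: bounded_mfunX..].
have /IH : forall i, (i < n)%N -> E (fun w => F i w ^+ 2) <= v.
  by move=> i ni; rewrite Fv// ltnW.
rewrite -/S => Sv.
apply: (@le_trans _ _ ((1 + n%:R^-1) * (n%:R ^+ 2 * v) + (1 + n%:R) * v)).
  by rewrite lerD// ler_wpM2l ?addr_ge0 ?invr_ge0 ?Fv.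
rewrite le_eqVlt; apply/orP; left; apply/eqP.
by rewrite -[n.+1]addn1 natrD; field; rewrite gt_eqF.
Qed.

Lemma covariance_bounded Y Z : bounded_mfun Y -> bounded_mfun Z ->
  `|E (fun w => Y w * Z w) - E Y * E Z| <= Num.sqrt (fine 'V_P[Y] * fine 'V_P[Z]).
Proof.
move=> bY bZ.
have Y1 := bounded_mfun_Lfun1 bY; have Z1 := bounded_mfun_Lfun1 bZ.
have Y2 := bounded_mfun_Lfun2 bY; have Z2 := bounded_mfun_Lfun2 bZ.
have YZ1 : (Y * Z)%R \in Lfun P 1 by exact/bounded_mfun_Lfun1/bounded_mfunM.
have covE : covariance P Y Z = (E (fun w => Y w * Z w) - E Y * E Z)%:E.
  rewrite covarianceE// EFinB EFinM !fineK ?expectation_fin_num//.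
have le1 A B : A \in Lfun P 2%:E -> B \in Lfun P 2%:E ->
    (covariance P A B <= (Num.sqrt (fine 'V_P[A] * fine 'V_P[B]))%:E)%E.
  move=> A2 B2; apply: (le_trans (covariance_le A2 B2)).
  rewrite -(fineK (variance_fin_num A2)) -(fineK (variance_fin_num B2)).
  by rewrite /= -EFinM sqrtrM// fine_ge0// variance_ge0.
rewrite ler_norml -!lee_fin EFinN -covE le1// andbT leeNl.
(* The lower bound is the upper bound applied to [- Y], which has the same variance. *)
rewrite -covarianceNl//.
have -> : fine 'V_P[Y] = fine 'V_P[(\- Y)%R] by rewrite varianceN.
apply: le1 => //; apply: bounded_mfun_Lfun2.
rewrite (_ : (\- Y)%R = fun w => -1 * Y w); first exact: bounded_mfunZ.
by apply/funext => w /=; rewrite mulN1r.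
Qed.

Lemma variance_le_sqr Y : bounded_mfun Y -> fine 'V_P[Y] <= E (fun w => Y w ^+ 2).
Proof.
move=> bY; have Y2 := bounded_mfun_Lfun2 bY.
have Y1 := bounded_mfun_Lfun1 bY.
have YY : (Y ^+ 2)%R \in Lfun P 1.
  by apply: bounded_mfun_Lfun1; exact: (bounded_mfunX 2 bY).
rewrite varianceE// fineB ?expectation_fin_num//; last first.
  by rewrite fin_numX// expectation_fin_num.
rewrite lerBlDr lerDl fine_ge0// sqre_ge0//.
Qed.

End expectation_bounded.

(** * Sums over blocks of a mixing sequence *)

Section blocks.
Context d (T : measurableType d) (R : realType) (P : probability T R).
Variable X : nat -> {RV P >-> R}.
Implicit Types (psi : nat -> R -> R) (j m n : nat).

Local Notation E Y := (fine 'E_P[Y]).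

Local Notation gen I :=
  (\bigcup_(i in I) preimage_set_system setT (X i : T -> R) measurable).

Lemma sigma_gen_measurable_fun (I : set nat) i : I i ->
  measurable_fun (setT : set (g_sigma_algebraType (gen I))) (X i : T -> R).
Proof.
move=> Ii _ B mB; apply: sub_sigma_algebra; exists i => //.
by exists B.
Qed.

Lemma L2_sigma_gen (I : set nat) (Y : T -> R) :
  measurable_fun (setT : set (g_sigma_algebraType (gen I))) Y ->
  bounded_mfun Y -> L2 P (sigma_gen X I) Y.
Proof.
move=> mY bY; split; last exact: bounded_mfun_Lfun2.
by move=> _ [B mB <-]; exact: mY.
Qed.

Lemma rho_covariance (g k : nat) (U V : T -> R) (r : R) :
  (rho P X g <= r%:E)%E -> (1 <= k)%N ->
  L2 P (past X k) U -> L2 P (future X (k + g)) V ->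
  bounded_mfun U -> bounded_mfun V ->
  `|E (fun w => U w * V w) - E U * E V| <=
  r * Num.sqrt (E (fun w => U w ^+ 2) * E (fun w => V w ^+ 2)).
Proof.
move=> rr k1 LU LV bU bV.
have c0 : abs_corr P U V <= r.
  rewrite -lee_fin; apply: le_trans rr.
  by apply: ereal_sup_ubound; exists k; split => //; exists U, V.
have VU : 0 <= fine 'V_P[U] by rewrite fine_ge0// variance_ge0.
have VV : 0 <= fine 'V_P[V] by rewrite fine_ge0// variance_ge0.
have r0 : 0 <= r by apply: le_trans c0; rewrite divr_ge0// sqrtr_ge0.
apply: (@le_trans _ _ (r * Num.sqrt (fine 'V_P[U] * fine 'V_P[V]))); last first.
  by rewrite ler_wpM2l// ler_wsqrtr// ler_pM// variance_le_sqr.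
(* When a variance vanishes, the quotient in [abs_corr] is 0 by convention and [c0] carries no
   information; Cauchy-Schwarz then gives a zero covariance. *)
have [s0|s0] := eqVneq (Num.sqrt (fine 'V_P[U] * fine 'V_P[V])) 0.
  by rewrite s0 mulr0 -[leRHS]s0; exact: covariance_bounded.
rewrite -ler_pdivrMr; last by rewrite lt_neqAle eq_sym s0 sqrtr_ge0.
exact: c0.
Qed.

(** The function [psi] may vary with the index because [centered_kernel] subtracts a mean taken
    separately at each index. *)
Definition block_sum psi j m (w : T) : R :=
  \sum_(i < m) psi (j + i)%N (X (j + i)%N w).

Lemma block0 psi j w : block_sum psi j 0 w = 0.
Proof. by rewrite /block_sum big_ord0. Qed.

Lemma blockD psi j m n w :
  block_sum psi j (m + n) w = block_sum psi j m w + block_sum psi (j + m) n w.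
Proof.
rewrite /block_sum big_split_ord/=; congr +%R.
by apply: eq_bigr => i _; rewrite addnA.
Qed.

Definition bounded_fam (M : R) psi :=
  (forall i, measurable_fun setT (psi i)) /\ forall i x, `|psi i x| <= M.

Lemma bounded_fam_mfun M psi i : bounded_fam M psi -> bounded_mfun (psi i \o X i).
Proof.
by move=> [mpsi bpsi]; split; [exact: measurableT_comp|exists M => w; exact: bpsi].
Qed.

Lemma bounded_mfun_block M psi j m :
  bounded_fam M psi -> bounded_mfun (block_sum psi j m).
Proof.
move=> bpsi.
apply: (@bounded_mfun_sum _ _ _ m (fun i w => psi (j + i)%N (X (j + i)%N w))).
by move=> i; exact: bounded_fam_mfun bpsi.
Qed.

Lemma block_norm_le M psi j m w : bounded_fam M psi ->
  `|block_sum psi j m w| <= m%:R * M.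
Proof.
move=> [_ bpsi]; rewrite (le_trans (ler_norm_sum _ _ _))//.
apply: (@le_trans _ _ (\sum_(i < m) M)); first exact: ler_sum.
by rewrite sumr_const card_ord mulr_natl.
Qed.

Lemma block_sigma_gen M psi (I : set nat) j m : bounded_fam M psi ->
  (forall i, (i < m)%N -> I (j + i)%N) ->
  measurable_fun (setT : set (g_sigma_algebraType (gen I))) (block_sum psi j m).
Proof.
move=> [mpsi _]; elim: m => [|m IH] Ij.
  rewrite (_ : block_sum psi j 0 = fun=> 0); first exact: measurable_cst.
  by apply/funext => w; rewrite block0.
rewrite (_ : block_sum psi j m.+1 =
  fun w => block_sum psi j m w + psi (j + m)%N (X (j + m)%N w)).
  apply: measurable_funD; first by apply: IH => i im; apply: Ij; exact: ltnW.
  apply: (measurableT_comp (mpsi (j + m)%N)).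
  by apply: sigma_gen_measurable_fun; apply: Ij.
by apply/funext => w; rewrite /block_sum big_ord_recr.
Qed.

(* The index [j + m] belongs to neither block, so that [k = j + m >= 1] can be
   taken as the end of the past even when [m = 0]. *)
Lemma block_covariance M psi (g j m j' m' : nat) (phi phi' : R -> R) (r : R) :
  bounded_fam M psi -> (rho P X g <= r%:E)%E ->
  (1 <= j)%N -> (j + m + g <= j')%N ->
  measurable_fun setT phi -> measurable_fun setT phi' ->
  bounded_mfun (phi \o block_sum psi j m) ->
  bounded_mfun (phi' \o block_sum psi j' m') ->
  `|E (fun w => phi (block_sum psi j m w) * phi' (block_sum psi j' m' w)) -
    E (fun w => phi (block_sum psi j m w)) *
    E (fun w => phi' (block_sum psi j' m' w))| <=
  r * Num.sqrt (E (fun w => phi (block_sum psi j m w) ^+ 2) *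
                E (fun w => phi' (block_sum psi j' m' w) ^+ 2)).
Proof.
move=> bpsi rr j1 jj mphi mphi' bU bV.
apply: (@rho_covariance g (j + m) _ _ r rr) => //.
- by rewrite addn_gt0 j1.
- apply: L2_sigma_gen => //; apply: measurableT_comp => //.
  apply: block_sigma_gen bpsi _ => i im /=.
  by rewrite addn_gt0 j1/= leq_add2l ltnW.
- apply: L2_sigma_gen => //; apply: measurableT_comp => //.
  by apply: block_sigma_gen bpsi _ => i im /=; rewrite (leq_trans jj)// leq_addr.
Qed.

End blocks.

(** * Splitting a block into two halves and a gap *)

Section recursion.
Context d (T : measurableType d) (R : realType) (P : probability T R).
Variable X : nat -> {RV P >-> R}.
Implicit Types (psi : nat -> R -> R) (j m n : nat).

Local Notation E Y := (fine 'E_P[Y]).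
Local Notation block := (block_sum X).

Definition sqr_bounded psi (v : R) :=
  forall i, (1 <= i)%N -> E (fun w => psi i (X i w) ^+ 2) <= v.

Lemma bounded_mfun_block_powR M psi (q : R) j m : bounded_fam M psi -> 0 <= q ->
  bounded_mfun (fun w => `|block psi j m w| `^ q).
Proof.
by move=> bpsi q0; apply: bounded_mfun_powR => //; exact: bounded_mfun_block bpsi.
Qed.

(** The factor [|S| ^ (q - 2)] is bounded by [(g M) ^ (q - 2)] pointwise, and [E S ^ 2] by
    [g ^ 2 v]. The estimate is linear in [v]; it serves for single terms ([g = 1]) and for the
    gaps. *)
Lemma block_moment_trivial M psi v (q : R) j m g :
  bounded_fam M psi -> sqr_bounded psi v -> 2 <= q -> 0 <= M -> 0 <= v ->
  (1 <= j)%N -> (m <= g)%N ->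
  E (fun w => `|block psi j m w| `^ q) <= M `^ (q - 2) * g%:R `^ q * v.
Proof.
move=> bpsi vpsi q2 M0 v0 j1 mg.
have q0 : 0 < q by exact: lt_le_trans q2.
have sqE (x : R) : 0 <= x -> x `^ q = x `^ (q - 2) * x ^+ 2.
  move=> x0; rewrite -powR_mulrn// -powRD ?subrK//.
  by rewrite gt_eqF.
have bb := bounded_mfun_block X j m bpsi.
apply: (@le_trans _ _ (E (fun w => (g%:R * M) `^ (q - 2) * block psi j m w ^+ 2))).
  apply: expect_le.
  - exact: bounded_mfun_block_powR bpsi (ltW q0).
  - by apply: bounded_mfunZ; exact: bounded_mfunX.
  move=> w; rewrite sqE// real_normK ?num_real// ler_wpM2r ?sqr_ge0//.
  rewrite ge0_ler_powR ?nnegrE ?subr_ge0 ?mulr_ge0//.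
  by rewrite (le_trans (block_norm_le X j m w bpsi))// ler_wpM2r// ler_nat.
rewrite expectZ; last exact: bounded_mfunX.
apply: (@le_trans _ _ ((g%:R * M) `^ (q - 2) * (g%:R ^+ 2 * v))); last first.
  rewrite powRM// (sqE g%:R)// le_eqVlt; apply/orP; left; apply/eqP; ring.
rewrite ler_wpM2l ?powR_ge0//.
apply: (@le_trans _ _ (m%:R ^+ 2 * v)).
  apply: (@expect_sqr_sum_le _ _ _ P m (fun i w => psi (j + i)%N (X (j + i)%N w))).
    by move=> i; exact: bounded_fam_mfun bpsi.
  by move=> i _; apply: vpsi; rewrite addn_gt0 j1.
by rewrite ler_wpM2r// lerXn2r ?nnegrE// ler_nat.
Qed.

(** The bounds are normalised as [2 ^ k b], so that doubling multiplies [b] by a factor close to 1.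
    The premise on two separated blocks is where mixing enters; the gap is detached by
    [powR_normD_gap] with [t = 1 / g] and estimated trivially. *)
Lemma block_moment_step M psi v (q t x b : R) g k :
  bounded_fam M psi -> sqr_bounded psi v -> 2 <= q -> 0 <= M -> 0 <= v ->
  (0 < g)%N ->
  (forall j m, (1 <= j)%N -> (m <= 2 ^ k)%N ->
    E (fun w => `|block psi j m w| `^ q) <= 2 ^+ k * b) ->
  (forall j m j' m', (1 <= j)%N -> (j + m + g <= j')%N ->
    (m <= 2 ^ k)%N -> (m' <= 2 ^ k)%N ->
    E (fun w => `|block psi j m w + block psi j' m' w| `^ q) <=
      2 * t * (2 ^+ k * b) + x) ->
  forall j m, (1 <= j)%N -> (m <= 2 ^ k.+1)%N ->
    E (fun w => `|block psi j m w| `^ q) <=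
    2 ^+ k.+1 * ((1 + pow_cst q * g%:R^-1) * (t * b + x / 2 ^+ k.+1) +
                 2 `^ q * M `^ (q - 2) * v * (g%:R `^ (2 * q) / 2 ^+ k.+1)).
Proof.
move=> bpsi vpsi q2 M0 v0 g0 Qk merge j m j1 mk.
have q0 : 0 < q by exact: lt_le_trans q2.
(* Left part, gap and right part. In a short block the gap may have fewer than [g] terms, but then
   the right part is empty and its starting index is immaterial. *)
pose m1 := minn m (2 ^ k).
pose m2 := minn g (m - m1).
pose m3 := (m - m1 - g)%N.
have mE : m = (m1 + (m2 + m3))%N by rewrite /m1 /m2 /m3; lia.
have k2 : (2 ^ k.+1 = 2 ^ k + 2 ^ k)%N by rewrite expnS mul2n addnn.
have m3k : (m3 <= 2 ^ k)%N by rewrite /m3 /m1; lia.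
pose A w := block psi j m1 w.
pose G w := block psi (j + m1) m2 w.
pose B w := block psi (j + m1 + g) m3 w.
have SE w : block psi j m w = A w + B w + G w.
  rewrite mE blockD blockD /A /B /G -addrA [X in _ = _ + X]addrC.
  congr (_ + (_ + _)).
  have [->|m30] := posnP m3; first by rewrite !block0.
  suff -> : m2 = g by [].
  by rewrite /m2; apply/minn_idPl; rewrite /m3 in m30; lia.
have gR : 0 < g%:R :> R by rewrite ltr0n.
have C0 : 0 <= pow_cst q by rewrite (le_trans _ (pow_cst_ge1 q)).
have bA : bounded_mfun A by exact: bounded_mfun_block bpsi.
have bB : bounded_mfun B by exact: bounded_mfun_block bpsi.
have bG : bounded_mfun G by exact: bounded_mfun_block bpsi.
have bAB : bounded_mfun (fun w => A w + B w) by exact: bounded_mfunD.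
have bABq := bounded_mfun_powR (ltW q0) bAB.
have bGq := bounded_mfun_powR (ltW q0) bG.
apply: (@le_trans _ _ (E (fun w => (1 + pow_cst q * g%:R^-1) * `|A w + B w| `^ q +
    (2 / g%:R^-1) `^ q * `|G w| `^ q))).
  apply: expect_le.
  - exact: bounded_mfun_block_powR bpsi (ltW q0).
  - by apply: bounded_mfunD; exact: bounded_mfunZ.
  - move=> w; rewrite SE; apply: powR_normD_gap; first exact: ltW.
    by rewrite invr_gt0 gR/= invf_le1// ler1n.
rewrite expectD; [|exact: bounded_mfunZ..].
rewrite !expectZ// mulrDr.
have -> : 2 ^+ k.+1 * ((1 + pow_cst q / g%:R) * (t * b + x / 2 ^+ k.+1)) =
    (1 + pow_cst q / g%:R) * (2 * t * (2 ^+ k * b) + x).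
  have : 2 ^+ k != 0 :> R by rewrite expf_neq0.
  move: (gt_eqF gR) => /negbT; rewrite exprS.
  move: (2 ^+ k) (g%:R) (pow_cst q) => y z c z0 y0.
  by field; rewrite z0 y0.
apply: lerD.
  rewrite ler_wpM2l ?addr_ge0 ?divr_ge0 ?(ltW gR)//.
  exact: (merge j m1 (j + m1 + g)%N m3 j1 (leqnn _) (geq_minr _ _) m3k).
have -> : 2 ^+ k.+1 * (2 `^ q * M `^ (q - 2) * v * (g%:R `^ (2 * q) / 2 ^+ k.+1)) =
   (2 / g%:R^-1) `^ q * (M `^ (q - 2) * g%:R `^ q * v).
  rewrite invrK powRM// (_ : 2 * q = q + q); last by ring.
  rewrite (@powRD _ g%:R q q) ?(gt_eqF gR) ?implybT//.
  have : 2 ^+ k.+1 != 0 :> R by rewrite expf_neq0.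
  by move: (2 ^+ k.+1) (2 `^ q) (g%:R `^ q) => y z c y0; field.
rewrite ler_wpM2l ?powR_ge0//.
apply: (block_moment_trivial bpsi) => //; first by rewrite addn_gt0 j1.
exact: geq_minl.
Qed.

End recursion.

(** * Geometric growth over the scales *)

Section scales.
Context {R : realType}.
Implicit Types (v mu beta q : R).

Lemma powR_scaleE v beta k : 0 < v ->
  (2 ^+ k * v) `^ beta = v `^ beta * (2 `^ (beta - 1)) ^+ k * 2 ^+ k.
Proof.
move=> v0; rewrite powRM ?exprn_ge0 ?(ltW v0)//.
rewrite -!(powR_mulrn k)// ?powR_ge0// -!powRrM -mulrA -powRD ?pnatr_eq0 ?implybT//.
rewrite mulrC; congr (_ * _ `^ _); ring.
Qed.

(** By [powR_scaleE], [(2 ^ k v) ^ beta / 2 ^ k] is geometric with ratio [kap = 2 ^ (beta - 1)].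
    Relative to the value at [N], the terms are at most [(mu / kap) ^ (N - k)], so the last scale
    dominates. *)
Lemma sum_scales_le v mu beta N : 0 < v -> 0 <= mu -> mu < 2 `^ (beta - 1) ->
  \sum_(k < N) mu ^+ (N - k) * (2 ^+ k * v) `^ beta / 2 ^+ k.+1 <=
  (1 - mu / 2 `^ (beta - 1))^-1 * ((2 ^+ N * v) `^ beta / 2 ^+ N).
Proof.
move=> v0 mu0 muk; set kap := 2 `^ (beta - 1) in muk *.
have k0 : 0 < kap by exact: le_lt_trans muk.
have x01 : 0 <= mu / kap < 1.
  by rewrite divr_ge0 ?(ltW k0)//= ltr_pdivrMr// mul1r.
rewrite powR_scaleE// -/kap mulfK ?expf_neq0//.
have vb : 0 <= v `^ beta * kap ^+ N by rewrite mulr_ge0 ?powR_ge0 ?exprn_ge0 ?(ltW k0).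
apply: le_trans (ler_wpM2r vb (sum_geo_rev_le N x01)).
rewrite mulr_suml; apply: ler_sum => k _; rewrite powR_scaleE// -/kap.
have -> : (mu / kap) ^+ (N - k) * (v `^ beta * kap ^+ N) =
    mu ^+ (N - k) * (v `^ beta * kap ^+ k).
  have -> : kap ^+ N = kap ^+ (N - k) * kap ^+ k.
    by rewrite -exprD subnK// ltnW.
  rewrite expr_div_n.
  have : kap ^+ (N - k) != 0 by rewrite expf_neq0// gt_eqF.
  by move: (kap ^+ (N - k)) => y y0; field.
rewrite -mulrA ler_wpM2l ?exprn_ge0// -[leRHS]mulr1 -!mulrA.
rewrite ler_wpM2l ?powR_ge0// ler_wpM2l ?exprn_ge0 ?(ltW k0)//.
by rewrite ler_pdivrMr ?exprn_gt0// mul1r ler_eXn2l// ltr1n.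
Qed.

(** Since [L >= 4 q], the numerator is at most [2 ^ (k / 2)] with real division in the exponent: the
    gaps are short enough for their total contribution to converge geometrically. *)
Lemma gap_scale_le q L k : 0 <= q -> 4 * q <= L%:R ->
  (2 ^ (k %/ L))%:R `^ (2 * q) / 2 ^+ k.+1 <= (2 `^ (- 2^-1)) ^+ k :> R.
Proof.
move=> q0 qL; rewrite natrX -!powR_mulrn ?powR_ge0// -!powRrM -powRN.
rewrite -powRD ?pnatr_eq0 ?implybT//.
rewrite ler_powR ?ler1n// -[k.+1]addn1 natrD.
have h : (k %/ L)%:R * L%:R <= k%:R :> R by rewrite -natrM ler_nat leq_divM.
have : (k %/ L)%:R * (4 * q) <= (k %/ L)%:R * L%:R :> R by rewrite ler_wpM2l.
lra.
Qed.

End scales.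

(** * Accumulating the errors over all scales *)

Section recursion.
Context d (T : measurableType d) (R : realType) (P : probability T R).
Variable X : nat -> {RV P >-> R}.

Local Notation E Y := (fine 'E_P[Y]).
Local Notation block := (block_sum X).

(* At scale [k], the parameter [t] of [powR_normD_prod] is the summable
   [u (k / L)] plus [lam ^ (N - k)]. The latter depends on the final scale [N]: it
   keeps the sum over [k < N] bounded while [t ^ (1 - r)] grows only like
   [mu ^ (N - k)], slowly enough to be absorbed by the geometric growth of the
   product terms. *)
Lemma moment_recursion (M q c lam mu D r r' W : R) (u : nat -> R) (L : nat) :
  2 <= q -> 0 <= M -> 0 <= c -> 0 <= lam < 1 ->
  0 <= mu -> mu < 2 `^ (r - 1) -> mu < 2 `^ (r' - 1) -> 0 <= D -> 4 * q <= L%:R ->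
  (forall i, 2 ^- i <= u i) -> (forall n, \sum_(i < n) u i <= W) ->
  exists C : R, 0 <= C /\ forall psi v,
    bounded_fam M psi -> sqr_bounded X psi v -> 0 < v ->
    (forall N k j m j' m' a, (k < N)%N -> (1 <= j)%N ->
      (j + m + 2 ^ (k %/ L) <= j')%N -> (m <= 2 ^ k)%N -> (m' <= 2 ^ k)%N ->
      E (fun w => `|block psi j m w| `^ q) <= a ->
      E (fun w => `|block psi j' m' w| `^ q) <= a ->
      E (fun w => `|block psi j m w + block psi j' m' w| `^ q) <=
        2 * (1 + c * (u (k %/ L)%N + lam ^+ (N - k))) * a +
        D * (mu ^+ (N - k) * ((2 ^+ k * v) `^ r + (2 ^+ k * v) `^ r'))) ->
    forall N j m, (1 <= j)%N -> (m <= 2 ^ N)%N ->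
      E (fun w => `|block psi j m w| `^ q) <=
      C * (2 ^+ N * v + D * ((2 ^+ N * v) `^ r + (2 ^+ N * v) `^ r')).
Proof.
move=> q2 M0 c0 lam01 mu0 mur mur' D0 qL u2 uW.
have q0 : 0 < q by exact: lt_le_trans q2.
have L0 : (0 < L)%N.
  by rewrite -(ltr_nat R) (lt_le_trans _ qL)// mulr_gt0.
have u0 i : 0 <= u i by rewrite (le_trans _ (u2 i))// invr_ge0 exprn_ge0.
pose Cq := pow_cst q.
have Cq0 : 0 <= Cq by rewrite (le_trans _ (pow_cst_ge1 q)).
pose K : R := 2 `^ q * M `^ (q - 2).
have K0 : 0 <= K by rewrite mulr_ge0 ?powR_ge0.
pose x : R := 2 `^ (- 2^-1).
have x01 : 0 <= x < 1.
  rewrite powR_ge0/= /x powRN invf_lt1 ?powR_gt0//.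
  have : (1 : R) `^ 2^-1 < 2 `^ 2^-1.
    by apply: gt0_ltr_powR; rewrite ?nnegrE ?invr_gt0// ltr1n.
  by rewrite powR1.
pose A := Cq * (L%:R * W) + c * (L%:R * W + (1 - lam)^-1).
pose G (beta : R) := (1 - mu / 2 `^ (beta - 1))^-1.
have G0 beta : mu < 2 `^ (beta - 1) -> 0 <= G beta.
  by move=> mub; rewrite invr_ge0 subr_ge0 ler_pdivrMr ?powR_gt0// mul1r ltW.
(* [A] bounds the sum of all relative errors. The terms of the other factor come from single
   variables, from the gaps and from the two families of product terms. *)
pose C := expR A * (M `^ (q - 2) + K * (1 - x)^-1 + G r + G r').
have x1 : 0 <= (1 - x)^-1 by rewrite invr_ge0 subr_ge0 ltW//; case/andP : x01.
exists C; split.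
  apply: mulr_ge0; first exact: expR_ge0.
  have := G0 _ mur; have := G0 _ mur'; have := mulr_ge0 K0 x1.
  by have := powR_ge0 M (q - 2); lra.
move=> psi v bpsi vpsi v0 merge N.
(* The relative error at scale [k]: the first term pays for detaching the gap, as
   [1 / g = 2 ^ - (k / L) <= u (k / L)], the second for merging the two halves. Below, [e1] and the
   rest of [e] are the additive errors of products and gaps, divided by [2 ^ (k + 1)]. *)
pose t k := Cq * u (k %/ L)%N + c * (u (k %/ L)%N + lam ^+ (N - k)).
pose e1 k :=
  D * (mu ^+ (N - k) * ((2 ^+ k * v) `^ r + (2 ^+ k * v) `^ r')) / 2 ^+ k.+1.
pose e k := e1 k + K * v * x ^+ k.
have lam0 : 0 <= lam by case/andP : lam01.
have x0 : 0 <= x by case/andP : x01.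
have e10 k : 0 <= e1 k.
  by rewrite !mulr_ge0 ?invr_ge0 ?exprn_ge0 ?addr_ge0 ?powR_ge0.
have Kv0 : 0 <= K * v by apply: mulr_ge0 => //; exact: ltW.
have e20 k : 0 <= K * v * x ^+ k by apply: mulr_ge0 => //; exact: exprn_ge0.
have t0 k : 0 <= t k.
  apply: addr_ge0; apply: mulr_ge0 => //.
  by apply: addr_ge0 => //; exact: exprn_ge0.
pose Q k b := forall j m, (1 <= j)%N -> (m <= 2 ^ k)%N ->
  E (fun w => `|block psi j m w| `^ q) <= 2 ^+ k * b.
have QN : Q N (expR (\sum_(k < N) t k) * (M `^ (q - 2) * v + \sum_(k < N) e k)).
  apply: gronwall_pred => //.
  - move=> k a b ab Qa j m j1 mk; apply: le_trans (Qa j m j1 mk) _.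
    by rewrite ler_wpM2l ?exprn_ge0.
  - by move=> k; exact: addr_ge0.
  - move=> j m j1; rewrite expn0 => m1; rewrite expr0 mul1r.
    have := block_moment_trivial bpsi vpsi q2 M0 (ltW v0) j1 m1.
    by rewrite powR1 mulr1.
  - by rewrite mulr_ge0 ?powR_ge0// ltW.
  move=> k b kN b0 Qk j m j1 mk.
  pose g := (2 ^ (k %/ L))%N.
  have g0 : (0 < g)%N by rewrite expn_gt0.
  set tau := u (k %/ L)%N + lam ^+ (N - k) in merge *.
  have tau0 : 0 <= tau by rewrite addr_ge0 ?exprn_ge0.
  have := block_moment_step (x := e1 k * 2 ^+ k.+1) (t := 1 + c * tau)
    bpsi vpsi q2 M0 (ltW v0) g0 Qk _ j1 mk.
  rewrite mulfK ?expf_neq0//.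
  move=> /(_ _)/le_trans; apply.
    move=> j2 m2 j3 m3 j21 jj m2k m3k.
    have j31 : (1 <= j3)%N.
      by apply: leq_trans jj; rewrite addn_gt0 addn_gt0 j21.
    have {}merge := merge N k _ _ _ _ _ kN j21 jj m2k m3k.
    apply: le_trans (merge _ (Qk _ _ j21 m2k) (Qk _ _ j31 m3k)) _.
    by rewrite /e1 divfK ?expf_neq0.
  rewrite ler_wpM2l ?exprn_ge0// /e addrA [leRHS]mulrDr.
  (* Both factors of the form [1 + y] are replaced by [expR y], the form that [gronwall_pred]
     expects. *)
  have gu : g%:R^-1 <= u (k %/ L)%N by rewrite /g natrX.
  have eC : 1 + Cq * g%:R^-1 <= expR (Cq * u (k %/ L)%N).
    by apply: le_trans (expR_ge1Dx _); rewrite lerD2l ler_wpM2l.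
  have et : 1 + c * tau <= expR (c * tau) by exact: expR_ge1Dx.
  have e1' : 1 <= expR (c * tau) by rewrite -expR0 ler_expR mulr_ge0.
  apply: lerD.
    rewrite /t -/tau expRD -mulrA.
    apply: ler_pM => //.
    - by rewrite addr_ge0// mulr_ge0// invr_ge0.
    - by rewrite addr_ge0// mulr_ge0// addr_ge0// mulr_ge0.
    rewrite [leRHS]mulrDr; apply: lerD; first exact: ler_wpM2r.
    by rewrite ler_peMl.
  rewrite -/K; apply: (@le_trans _ _ (K * v * x ^+ k)).
    apply: ler_wpM2l => //; apply: gap_scale_le => //.
    exact: ltW.
  by rewrite ler_peMl// -expR0 ler_expR.
move=> j m j1 mN; apply: le_trans (QN j m j1 mN) _.
set s := 2 ^+ N * v.
have s0 : 0 < s by rewrite mulr_gt0 ?exprn_gt0.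
have tA : \sum_(k < N) t k <= A.
  rewrite /t big_split/= -!mulr_sumr big_split/=.
  have := sum_divn_le N L0 u0 uW.
  move: (\sum_(k < N) u _) => y yLW.
  rewrite lerD// ler_wpM2l// lerD//.
  exact: sum_geo_rev_le.
have eS : \sum_(k < N) e k <=
    D * (G r * (s `^ r / 2 ^+ N) + G r' * (s `^ r' / 2 ^+ N)) + K * v * (1 - x)^-1.
  rewrite /e big_split/= -mulr_sumr lerD//; last first.
    by rewrite ler_wpM2l// sum_geo_le.
  rewrite /e1; under eq_bigr do rewrite -mulrA [_ * (_ + _)]mulrDr mulrDl.
  rewrite -mulr_sumr ler_wpM2l// big_split/= lerD//; exact: sum_scales_le.
have Mv : 0 <= M `^ (q - 2) * v by rewrite mulr_ge0 ?powR_ge0// ltW.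
apply: (@le_trans _ _ (2 ^+ N * (expR A * (M `^ (q - 2) * v +
    (D * (G r * (s `^ r / 2 ^+ N) + G r' * (s `^ r' / 2 ^+ N)) + K * v * (1 - x)^-1))))).
  rewrite ler_wpM2l ?exprn_ge0// ler_pM ?expR_ge0//.
  - by rewrite addr_ge0// sumr_ge0// => k _; exact: addr_ge0.
  - by rewrite ler_expR.
  - by rewrite lerD2l.
have -> : 2 ^+ N * (expR A * (M `^ (q - 2) * v +
    (D * (G r * (s `^ r / 2 ^+ N) + G r' * (s `^ r' / 2 ^+ N)) + K * v * (1 - x)^-1))) =
  expR A * ((M `^ (q - 2) + K * (1 - x)^-1) * s + D * (G r * s `^ r + G r' * s `^ r')).
  rewrite /s; have : 2 ^+ N != 0 :> R by rewrite expf_neq0.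
  move: (_ `^ r) (_ `^ r') (1 - x)^-1 => a1 a2 a3.
  by move: (2 ^+ N) => y y0; field.
rewrite /C -mulrA ler_wpM2l ?expR_ge0//.
have Gr := G0 _ mur; have Gr' := G0 _ mur'.
have S0 : 0 <= s `^ r + s `^ r' by rewrite addr_ge0 ?powR_ge0.
have MK0 : 0 <= M `^ (q - 2) + K * (1 - x)^-1.
  by apply: addr_ge0; [exact: powR_ge0|exact: mulr_ge0].
move: MK0; set m0 := M `^ _ + _ => MK0.
rewrite [leRHS]mulrDr; apply: lerD.
  by apply: ler_wpM2r; [exact: ltW|lra].
rewrite [leRHS]mulrCA ler_wpM2l// [leRHS]mulrDr.
by apply: lerD; apply: ler_wpM2r; rewrite ?powR_ge0//; lra.
Qed.

End recursion.

(** * Rosenthal's inequality *)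

Section rosenthal.
Context d (T : measurableType d) (R : realType) (P : probability T R).
Variable X : nat -> {RV P >-> R}.
Implicit Types (psi : nat -> R -> R) (u : nat -> R) (W : R).

Local Notation E Y := (fine 'E_P[Y]).
Local Notation block := (block_sum X).

Definition centered_fam psi :=
  forall i, (1 <= i)%N -> E (fun w => psi i (X i w)) = 0.

Definition rosenthal (M q : R) := exists D : R, 0 <= D /\ forall psi v,
  bounded_fam M psi -> centered_fam psi -> sqr_bounded X psi v -> 0 < v ->
  forall N j m, (1 <= j)%N -> (m <= 2 ^ N)%N ->
  E (fun w => `|block psi j m w| `^ q) <=
  D * ((2 ^+ N * v) `^ (q / 2) + 2 ^+ N * v).

Lemma expect_block M psi j m : bounded_fam M psi -> centered_fam psi ->
  (1 <= j)%N -> E (block psi j m) = 0.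
Proof.
move=> bpsi cpsi j1; elim: m => [|m IH].
  rewrite (_ : block psi j 0 = fun=> 0) ?expect_cst//.
  by apply/funext => w; rewrite block0.
rewrite (_ : block psi j m.+1 =
    fun w => block psi j m w + psi (j + m)%N (X (j + m)%N w)); last first.
  by apply/funext => w; rewrite /block_sum big_ord_recr.
rewrite expectD ?IH ?add0r ?cpsi ?addn_gt0 ?j1//.
  exact: bounded_mfun_block bpsi.
exact: (bounded_fam_mfun X (j + m) bpsi).
Qed.

(** Adding [2 ^ - i] to [u i] keeps the series bounded and provides the lower bound on [u] that
    [moment_recursion] asks for. *)
Lemma sum_add_pow2_le u W n : (forall n, \sum_(i < n) u i <= W) ->
  \sum_(i < n) (u i + 2 ^- i) <= W + 2.
Proof.
move=> uW; rewrite big_split/=; apply: lerD; first exact: uW.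
rewrite (eq_bigr (fun i : 'I_n => 2^-1 ^+ i)); last by move=> i _; rewrite exprVn.
have half01 : 0 <= (2^-1 : R) < 1 by rewrite invr_ge0 ler0n invf_lt1 ?ltr1n.
apply: le_trans (sum_geo_le n half01) _.
by rewrite (_ : (1 - 2^-1)^-1 = 2) //; field.
Qed.

Lemma sqrt_mul_le (x y a : R) : 0 <= x -> x <= a -> y <= a -> Num.sqrt (x * y) <= a.
Proof.
move=> x0 xa ya; have a0 : 0 <= a by exact: le_trans xa.
rewrite -[leRHS]ger0_norm// -sqrtr_sqr; apply: ler_wsqrtr.
apply: (@le_trans _ _ (x * a)); first exact: ler_wpM2l.
by rewrite expr2; exact: ler_wpM2r.
Qed.

(** In [E (A + B) ^ 2] the cross term is a covariance, because the blocks are centered, and mixing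
    bounds it by [u (k / L) a]. The error is thus purely relative: [moment_recursion] is used with
    [c = 1], [lam = mu = D = 0] and [L = 8 = 4 q]. *)
Lemma rosenthal2 M u W : 0 <= M -> (forall i, 0 <= u i) ->
  (forall n, \sum_(i < n) u i <= W) ->
  (forall i, (rho P X (2 ^ i) <= (u i)%:E)%E) -> rosenthal M 2.
Proof.
move=> M0 u0 uW rhou.
have [||||||||||C [C0 H]] := @moment_recursion _ _ _ _ X M 2 1 0 0 0 2 2 (W + 2)
  (fun i => u i + 2 ^- i) 8 _ M0.
- exact: lexx.
- exact: ler01.
- by rewrite lexx ltr01.
- exact: lexx.
- exact: powR_gt0.
- exact: powR_gt0.
- exact: lexx.
- lra.
- by move=> i; rewrite lerDr.
- by move=> n; exact: sum_add_pow2_le.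
exists C; split => // psi v bpsi cpsi vpsi v0 N j m j1 mN.
have s0 : 0 <= 2 ^+ N * v by rewrite mulr_ge0 ?exprn_ge0// ltW.
apply: (le_trans (H psi v bpsi vpsi v0 _ N j m j1 mN)); last first.
  by rewrite mul0r addr0 ler_wpM2l// lerDr powR_ge0.
move=> {j m j1 mN s0}N0 k j m j' m' a kN j1 jj mk m'k.
set A := block psi j m; set B := block psi j' m' => Aa Ba.
have j'1 : (1 <= j')%N.
  by apply: leq_trans jj; rewrite !addn_gt0 j1.
have sqE (Y : T -> R) : E (fun w => `|Y w| `^ 2) = E (fun w => Y w ^+ 2).
  congr (fine _); congr (expectation _ _); apply/funext => w.
  by rewrite powR_mulrn// real_normK// num_real.
rewrite !sqE in Aa Ba *.
have bA : bounded_mfun A by exact: bounded_mfun_block bpsi.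
have bB : bounded_mfun B by exact: bounded_mfun_block bpsi.
have EA0 : 0 <= E (fun w => A w ^+ 2) by apply: expect_ge0 => w; exact: sqr_ge0.
have a0 : 0 <= a by exact: le_trans Aa.
have cov := @block_covariance _ _ _ _ X M psi _ j m j' m' id id _ bpsi
  (rhou (k %/ 8)%N)  j1 jj (@measurable_id _ _ _) (@measurable_id _ _ _) bA bB.
have {cov} AB : E (fun w => A w * B w) <= u (k %/ 8)%N * a.
  move: cov; rewrite (_ : E (fun w => id (block psi j m w)) = 0); last first.
    exact: expect_block bpsi cpsi j1.
  rewrite mul0r subr0 => /(le_trans (ler_norm _))/le_trans; apply.
  rewrite ler_wpM2l//; exact: sqrt_mul_le.
have -> : (fun w => (A w + B w) ^+ 2) =
    (fun w => (A w ^+ 2 + B w ^+ 2) + 2 * (A w * B w)).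
  by apply/funext => w; ring.
have bA2 := bounded_mfunX 2 bA; have bB2 := bounded_mfunX 2 bB.
have bAB := bounded_mfunM bA bB.
rewrite expectD; [|exact: bounded_mfunD|exact: bounded_mfunZ].
rewrite expectD// expectZ// mul0r addr0 expr0n subn_eq0 leqNgt kN/= addr0 mul1r.
have : 0 <= 2 ^- (k %/ 8) * a by rewrite mulr_ge0// invr_ge0 exprn_ge0.
lra.
Qed.

(** Passage from moments of order [r] to order [2 r]. The exponent [r'] covers both ways in which
    the former are known: [r' = r] when [r <= 2], and [r' = 2] when [r > 2]. *)
Lemma rosenthal_double M r r' D0 u W : 0 <= M -> 1 < r' -> r' <= r -> 0 <= D0 ->
  (forall i, 0 <= u i) -> (forall n, \sum_(i < n) u i <= W) ->
  (forall i, (rho P X (2 ^ i) <= (u i `^ r)%:E)%E) ->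
  (forall psi v,
    bounded_fam M psi -> centered_fam psi -> sqr_bounded X psi v -> 0 < v ->
    forall N j m, (1 <= j)%N -> (m <= 2 ^ N)%N ->
    E (fun w => `|block psi j m w| `^ r) ^+ 2 <=
      D0 * ((2 ^+ N * v) `^ r + (2 ^+ N * v) `^ r')) ->
  rosenthal M (2 * r).
Proof.
move=> M0 r'1 r'r D00 u0 uW rhou mom.
have r1 : 1 < r by exact: lt_le_trans r'r.
have r0 : 0 < r by exact: lt_trans r1.
(* [mu] lies strictly between 1 and [2 ^ (r' - 1)], and [lam < 1] is then determined by
   [lam ^ (1 - r) = mu]. *)
pose mu : R := 2 `^ ((r' - 1) / 2).
have pow2_lt (a b : R) : a < b -> 2 `^ a < 2 `^ b :> R.
  move=> ab; rewrite -subr_gt0 -(subrK a b) powRD ?pnatr_eq0 ?implybT//.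
  have -> : 2 `^ (b - a) * 2 `^ a - 2 `^ a = (2 `^ (b - a) - 1) * 2 `^ a :> R by ring.
  rewrite mulr_gt0 ?powR_gt0// subr_gt0.
  have : (1 : R) `^ (b - a) < 2 `^ (b - a).
    by apply: gt0_ltr_powR; rewrite ?subr_gt0 ?nnegrE ?ltr1n.
  by rewrite powR1.
have mu_lt b : r' <= b -> mu < 2 `^ (b - 1) by move=> r'b; apply: pow2_lt; lra.
have mu1 : 1 < mu by rewrite -(powRr0 2); apply: pow2_lt; lra.
have mu0 : 0 < mu by exact: lt_trans mu1.
pose lam : R := mu `^ (- (r - 1)^-1).
have lam0 : 0 < lam by exact: powR_gt0.
have rr0 : 0 < r - 1 by rewrite subr_gt0.
have lam1 : lam < 1.
  rewrite /lam powRN invf_lt1 ?powR_gt0//.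
  have : (1 : R) `^ (r - 1)^-1 < mu `^ (r - 1)^-1.
    by apply: gt0_ltr_powR; rewrite ?invr_gt0 ?nnegrE ?(ltW mu0).
  by rewrite powR1.
have lamE n : (lam ^+ n) `^ (1 - r) = mu ^+ n.
  rewrite /lam -powR_mulrn ?powR_ge0// -2!powRrM -[RHS]powR_mulrn ?(ltW mu0)//.
  congr (_ `^ _).
  by field; rewrite gt_eqF.
pose Cq := pow_cst (2 * r).
have Cq1 : 1 <= Cq := pow_cst_ge1 _.
have Cq0 : 0 <= Cq by exact: le_trans Cq1.
pose L := Num.bound (8 * r).
pose D := Cq * D0.
have DD : 0 <= D by exact: mulr_ge0.
(* [c = 2 Cq] suffices: the inequality for [|A + B| ^ (2 r)] costs [2 Cq tau a], and the mixing
   error at most another [Cq tau a]. *)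
have [||||||||||C [C0 H]] := @moment_recursion _ _ _ _ X M (2 * r) (2 * Cq)
  lam mu D r r' (W + 2) (fun i => u i + 2 ^- i) L _ M0.
- lra.
- exact: mulr_ge0.
- by rewrite ltW.
- exact: ltW.
- exact: mu_lt.
- exact: mu_lt.
- exact: DD.
- have : 8 * r < L%:R by apply: archi_boundP; rewrite mulr_ge0// ltW.
  lra.
- by move=> i; rewrite lerDr.
- by move=> n; exact: sum_add_pow2_le.
exists (C * (1 + 2 * D)); split; first by rewrite mulr_ge0// addr_ge0// mulr_ge0.
move=> psi v bpsi cpsi vpsi v0 N j m j1 mN.
set s := 2 ^+ N * v.
have s0 : 0 < s by rewrite mulr_gt0 ?exprn_gt0.
apply: (le_trans (H psi v bpsi vpsi v0 _ N j m j1 mN)); last first.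
  have -> : 2 * r / 2 = r by field.
  rewrite -/s -mulrA ler_wpM2l//.
  have sr0 := powR_ge0 s r.
  (* As [1 < r' <= r], the power [s ^ r'] is below [s ^ r] when [s >= 1] and below [s] when
     [s <= 1]. *)
  have sr' : s `^ r' <= s `^ r + s.
    have [s1|s1] := leP 1 s.
      by apply: (@le_trans _ _ (s `^ r)); [exact: ler_powR|rewrite lerDl ltW].
    apply: (@le_trans _ _ s); last by rewrite lerDr.
    by rewrite ge1r_powR ?s0 ?ltW.
  have h2 : D * s `^ r' <= D * (s `^ r + s) by exact: ler_wpM2l.
  have : 0 <= D * s by rewrite mulr_ge0// ltW.
  nra.
move=> {j m j1 mN s s0}N0 k j m j' m' a kN j1 jj mk m'k.
set A := block psi j m; set B := block psi j' m' => Aa Ba.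
have j'1 : (1 <= j')%N.
  by apply: leq_trans jj; rewrite !addn_gt0 j1.
set uk := u (k %/ L)%N.
have uk0 : 0 <= uk by exact: u0.
set tau := uk + 2 ^- (k %/ L) + lam ^+ (N0 - k).
have p2 : 0 <= 2 ^- (k %/ L) :> R by rewrite invr_ge0 exprn_ge0.
have ln0 : 0 < lam ^+ (N0 - k) by exact: exprn_gt0.
have tau0 : 0 < tau by rewrite ltr_wpDl// addr_ge0.
have utau : uk <= tau by rewrite /tau -addrA lerDl addr_ge0// ltW.
have bA : bounded_mfun A by exact: bounded_mfun_block bpsi.
have bB : bounded_mfun B by exact: bounded_mfun_block bpsi.
have bAq := bounded_mfun_powR (ltW (mulr_gt0 (ltr0n R 2) r0)) bA.
have bBq := bounded_mfun_powR (ltW (mulr_gt0 (ltr0n R 2) r0)) bB.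
have bAr := bounded_mfun_powR (ltW r0) bA.
have bBr := bounded_mfun_powR (ltW r0) bB.
have bABq := bounded_mfun_powR (ltW (mulr_gt0 (ltr0n R 2) r0))
  (bounded_mfunD bA bB).
have EA0 : 0 <= E (fun w => `|A w| `^ (2 * r)).
  by apply: expect_ge0 => w; exact: powR_ge0.
have a0 : 0 <= a by exact: le_trans Aa.
have sqE (Y : T -> R) :
    E (fun w => (`|Y w| `^ r) ^+ 2) = E (fun w => `|Y w| `^ (2 * r)).
  congr (fine _); congr (expectation _ _); apply/funext => w.
  by rewrite -powR_mulrn ?powR_ge0// -powRrM mulrC.
set S := (2 ^+ k * v) `^ r + (2 ^+ k * v) `^ r'.
have S0 : 0 <= S by rewrite addr_ge0 ?powR_ge0.
(* The product of the two expectations is at most half the sum of their squares, which [mom] bounds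
   by [D0 S]; the covariance is at most [uk ^ r a]. *)
have AB : E (fun w => `|A w| `^ r * `|B w| `^ r) <= D0 * S + uk `^ r * a.
  have mphi : measurable_fun setT (fun x : R => `|x| `^ r).
    exact: (measurableT_comp (measurable_powR r)).
  have := @block_covariance _ _ _ _ X M psi _ j m j' m' (fun x => `|x| `^ r)
    (fun x => `|x| `^ r) _ bpsi (rhou (k %/ L)%N) j1 jj mphi mphi bAr bBr.
  rewrite -/uk -/A -/B !sqE => /(le_trans (ler_norm _)).
  have hA := mom psi v bpsi cpsi vpsi v0 k j m j1 mk.
  have hB := mom psi v bpsi cpsi vpsi v0 k j' m' j'1 m'k.
  rewrite -/A -/S in hA; rewrite -/B -/S in hB.
  have : uk `^ r * Num.sqrt (E (fun w => `|A w| `^ (2 * r)) *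
      E (fun w => `|B w| `^ (2 * r))) <=
    uk `^ r * a by rewrite ler_wpM2l ?powR_ge0// sqrt_mul_le.
  move: hA hB; move: (E _) (E _) (E _) => x y z hx hy.
  have := sqr_ge0 (x - y).
  move: (D0 * S) hx hy (uk `^ r * _) (uk `^ r * a) => ? ? ? ? ?; nra.
apply: (@le_trans _ _ (E (fun w =>
  (1 + Cq * tau) * (`|A w| `^ (2 * r) + `|B w| `^ (2 * r)) +
  Cq * tau `^ (1 - r) * (`|A w| `^ r * `|B w| `^ r)))).
  apply: expect_le => //.
    apply: bounded_mfunD; apply: bounded_mfunZ; first exact: bounded_mfunD.
    exact: bounded_mfunM.
  by move=> w; apply: powR_normD_prod => //; exact: ltW.
rewrite expectD; [|by apply: bounded_mfunZ; exact: bounded_mfunD|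
  by apply: bounded_mfunZ; exact: bounded_mfunM].
rewrite expectZ; last exact: bounded_mfunD.
rewrite (expectD _ bAq bBq) expectZ; last exact: bounded_mfunM.
(* Two lower bounds on [tau] are used with the negative exponent [1 - r]: [tau >= lam ^ (N0 - k)]
   controls the product terms, and [tau >= uk] makes the mixing error relative of size [tau]. *)
have tpow : tau `^ (1 - r) <= mu ^+ (N0 - k).
  rewrite -lamE -opprB !powRN lef_pV2 ?posrE ?powR_gt0//.
  rewrite ge0_ler_powR ?nnegrE ?(ltW rr0) ?(ltW tau0) ?(ltW ln0)//.
  by rewrite /tau lerDr addr_ge0.
have tu : tau `^ (1 - r) * uk `^ r <= tau.
  apply: (@le_trans _ _ (tau `^ (1 - r) * tau `^ r)).
    by rewrite ler_wpM2l ?powR_ge0// ge0_ler_powR ?nnegrE ?(ltW r0) ?(ltW tau0).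
  by rewrite -powRD ?(gt_eqF tau0) ?implybT// subrK powRr1// ltW.
have h1 : (1 + Cq * tau) * (E (fun w => `|A w| `^ (2 * r)) +
    E (fun w => `|B w| `^ (2 * r))) <= (1 + Cq * tau) * (a + a).
  by rewrite ler_wpM2l ?lerD// addr_ge0// mulr_ge0// ltW.
have h2 : Cq * tau `^ (1 - r) * E (fun w => `|A w| `^ r * `|B w| `^ r) <=
    Cq * tau `^ (1 - r) * (D0 * S + uk `^ r * a).
  by rewrite ler_wpM2l// mulr_ge0 ?powR_ge0.
have h3 : Cq * tau `^ (1 - r) * (D0 * S) <= D * (mu ^+ (N0 - k) * S).
  rewrite /D -!mulrA ler_wpM2l// mulrCA ler_wpM2l//.
  by rewrite ler_wpM2r.
have h4 : Cq * (tau `^ (1 - r) * uk `^ r) * a <= Cq * tau * a.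
  by rewrite ler_wpM2r// ler_wpM2l.
have : 0 <= Cq * tau * a by rewrite !mulr_ge0// ltW.
move: h1 h2 h3 h4; lra.
Qed.

(** Induction on [n] with [q <= 2 ^ (n + 1)], halving [q] at each step. Order [r = q / 2] is handled
    through the second moment if [r <= 2], and by the induction hypothesis otherwise. *)
Lemma rosenthal_rho M q u W : 0 <= M -> 2 <= q ->
  (forall i, 0 <= u i) -> (forall n, \sum_(i < n) u i <= W) ->
  (forall i, (rho P X (2 ^ i) <= (u i `^ (q / 2))%:E)%E) -> rosenthal M q.
Proof.
move=> M0 q2.
have [n qn] : exists n, q <= 2 ^+ n.+1.
  exists (Num.bound q); rewrite (le_trans (ltW (archi_boundP _)))//.
    exact: le_trans q2.
  by rewrite -natrX ler_nat (leq_trans (ltnW (ltn_expl _ (ltnSn 1))))// leq_exp2l.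
elim: n q q2 qn u W => [|n IH] q q2 qn u W u0 uW rhou.
  have q2E : q = 2 by apply/eqP; rewrite eq_le q2 andbT.
  rewrite q2E; apply: (rosenthal2 M0 u0 uW) => i.
  by rewrite (le_trans (rhou i))// q2E divff// powRr1.
have uleW i : u i <= W.
  apply: le_trans (uW i.+1); rewrite big_ord_recr/= lerDr; exact: sumr_ge0.
have W0 : 0 <= W by apply: le_trans (uleW 0).
have [q2'|q2'] := leP q 2.
  have q2E : q = 2 by apply/eqP; rewrite eq_le q2 andbT.
  rewrite q2E; apply: (rosenthal2 M0 u0 uW) => i.
  by rewrite (le_trans (rhou i))// q2E divff// powRr1.
pose r := q / 2.
have r1 : 1 < r by rewrite /r ltr_pdivlMr// mul1r.
have qE : q = 2 * r by rewrite /r mulrCA divff ?mulr1.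
have rn : r <= 2 ^+ n.+1 by rewrite /r ler_pdivrMr// -exprSr.
have sumZ c : 0 <= c -> forall n, \sum_(i < n) c * u i <= c * W.
  by move=> c0 m; rewrite -mulr_sumr ler_wpM2l.
have [r2|r2] := leP r 2.
(* The second moment needs a summable bound on [rho] itself: [u ^ r <= W ^ (r - 1) u], because
   [u <= W]. *)
- have u'0 i : 0 <= W `^ (r - 1) * u i by rewrite mulr_ge0 ?powR_ge0.
  have [|D [D0 HD]] := rosenthal2 M0 u'0 (sumZ _ (powR_ge0 _ _)).
    move=> i; apply: (le_trans (rhou i)); rewrite lee_fin -/r.
    have -> : u i `^ r = u i `^ (r - 1) * u i.
      rewrite -[X in _ * X]powRr1// -powRD ?subrK// gt_eqF//.
      exact: lt_trans r1.
    rewrite ler_wpM2r// ge0_ler_powR ?nnegrE// subr_ge0 ltW//.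
  rewrite qE; apply: (@rosenthal_double M r r ((1 + 2 * D) ^+ 2) u W) => //.
    exact: sqr_ge0.
  move=> psi v bpsi cpsi vpsi v0 N j m j1 mN.
  set s := 2 ^+ N * v.
  have s0 : 0 < s by rewrite mulr_gt0 ?exprn_gt0.
  have bb := bounded_mfun_block X j m bpsi.
  have E0 : 0 <= E (fun w => `|block psi j m w| `^ r).
    by apply: expect_ge0 => w; exact: powR_ge0.
  have Er : E (fun w => `|block psi j m w| `^ r) <= (1 + 2 * D) * s `^ (r / 2).
    apply: (@le_trans _ _ (E (fun w =>
        s `^ (r / 2) + s `^ (r / 2 - 1) * block psi j m w ^+ 2))).
      apply: expect_le.
      - by apply: bounded_mfun_powR => //; lra.
      - by apply: bounded_mfunD => //; apply: bounded_mfunZ; exact: bounded_mfunX.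
      - by move=> w; apply: powR_norm_le_sqr => //; rewrite r2 andbT; lra.
    rewrite expectD//; last by apply: bounded_mfunZ; exact: bounded_mfunX.
    rewrite expect_cst expectZ; last exact: bounded_mfunX.
    have := HD psi v bpsi cpsi vpsi v0 N j m j1 mN.
    rewrite -/s divff// powRr1 ?(ltW s0)//.
    have -> : (fun w => `|block psi j m w| `^ 2) = (fun w => block psi j m w ^+ 2).
      by apply/funext => w; rewrite powR_mulrn// real_normK// num_real.
    move=> h; have sE : s `^ (r / 2 - 1) * s = s `^ (r / 2).
      rewrite -[X in _ * X]powRr1 ?(ltW s0)// -powRD ?subrK// (gt_eqF s0) implybT//.
    have := ler_wpM2l (powR_ge0 s (r / 2 - 1)) h.
    move: sE; set y := s `^ (r / 2 - 1) => <-; lra.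
  apply: (@le_trans _ _ (((1 + 2 * D) * s `^ (r / 2)) ^+ 2)).
    by rewrite lerXn2r ?nnegrE ?mulr_ge0 ?powR_ge0 ?addr_ge0 ?mulr_ge0.
  rewrite exprMn -[X in _ * X <= _]powR_mulrn ?powR_ge0// -powRrM divfK//.
  by rewrite ler_wpM2l ?sqr_ge0// lerDl powR_ge0.
(* Order [r] needs [rho] bounded by the power [r / 2] of a summable sequence: [u ^ r = (u ^ 2) ^ (r
   / 2) <= (W u) ^ (r / 2)]. *)
- have u'0 i : 0 <= W * u i by rewrite mulr_ge0.
  have [|D [D0 HD]] := IH r (ltW r2) rn _ _ u'0 (sumZ _ W0).
    move=> i; apply: (le_trans (rhou i)); rewrite lee_fin -/r.
    have -> : u i `^ r = (u i ^+ 2) `^ (r / 2).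
      by rewrite -powR_mulrn// -powRrM mulrCA divff ?mulr1.
    rewrite ge0_ler_powR ?nnegrE ?sqr_ge0//; first by lra.
    by rewrite expr2 ler_wpM2r.
  rewrite qE; apply: (@rosenthal_double M r 2 (2 * D ^+ 2) u W) => //.
  + exact: ltr1n.
  + exact: ltW.
  + by rewrite mulr_ge0 ?sqr_ge0.
  move=> psi v bpsi cpsi vpsi v0 N j m j1 mN.
  have E0 : 0 <= E (fun w => `|block psi j m w| `^ r).
    by apply: expect_ge0 => w; exact: powR_ge0.
  have := HD psi v bpsi cpsi vpsi v0 N j m j1 mN.
  set s := 2 ^+ N * v.
  have s0 : 0 < s by rewrite mulr_gt0 ?exprn_gt0.
  have -> : s `^ r = (s `^ (r / 2)) ^+ 2.
    by rewrite -powR_mulrn ?powR_ge0// -powRrM divfK.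
  rewrite powR_mulrn ?(ltW s0)//.
  move: (s `^ (r / 2)) (powR_ge0 s (r / 2)) => y y0 h.
  apply: (@le_trans _ _ ((D * (y + s)) ^+ 2)).
    by rewrite lerXn2r ?nnegrE ?mulr_ge0 ?addr_ge0 ?(ltW s0).
  rewrite exprMn -[leRHS]mulrA [leRHS]mulrCA ler_wpM2l ?sqr_ge0//.
  by have := sqr_ge0 (y - s); nra.
Qed.

End rosenthal.

(** * Kernel estimators *)

Section affine.
Context {R : realType}.

Lemma measurable_affine (x h : R) : measurable_fun setT (fun y : R => (y - x) / h).
Proof.
by apply: measurable_funM => //; exact: measurable_funB.
Qed.

(** The image of Lebesgue measure under the map, divided by [h], agrees with Lebesgue measure on
    half-open intervals, hence everywhere by uniqueness. *)
Lemma lebesgue_measure_affine (x h : R) (A : set R) : 0 < h -> measurable A ->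
  lebesgue_measure ((fun y => (y - x) / h) @^-1` A) =
  (h%:E * lebesgue_measure A)%E.
Proof.
move=> h0 mA.
have hV : 0 <= h^-1 by rewrite invr_ge0 ltW.
pose phi : measurableTypeR R -> measurableTypeR R := fun y : R => (y - x) / h.
have mphi : measurable_fun setT phi by exact: measurable_affine.
pose m : {measure set (measurableTypeR R) -> \bar R} :=
  mscale (NngNum hV) (pushforward (@lebesgue_measure R) phi).
have -> : lebesgue_measure A = m mphi A.
  apply: (lebesgue_measure_unique (mu := m mphi)) => // _ [[a b] _ <-] /=.
  rewrite /m /mscale /= /pushforward.
  have -> : phi @^-1` (`]a, b]%classic : set R) =
      (`](h * a + x), (h * b + x)]%classic : set R).
    apply/seteqP; split => y /=; rewrite !in_itv /= /phi;
      rewrite ltr_pdivlMr// ler_pdivrMr// -ltrBrDr -lerBlDr.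
    by rewrite mulrC => /andP[-> +]; rewrite mulrC.
    by rewrite mulrC => /andP[-> +]; rewrite mulrC.
  rewrite !lebesgue_measure_itv /= !lte_fin ltrD2r ltr_pM2l//.
  case: ifPn => _; last by rewrite mule0.
  by rewrite -!EFinB -EFinM; congr EFin; field; rewrite gt_eqF.
rewrite /m /mscale /= muleA -EFinM divff ?mul1e// gt_eqF//.
Qed.

End affine.

(** * Laws with a bounded density *)

Section density.
Context d (T : measurableType d) (R : realType) (P : probability T R).
Local Notation mu := (@lebesgue_measure R).

Lemma distribution_density_le (Y : {RV P >-> R}) (f : R -> R) (M : R) (A : set R) :
  has_density Y f -> (forall x, `|f x| <= M) -> measurable A ->
  (distribution P Y A <= M%:E * mu A)%E.
Proof.
move=> [mf f0 Yf] fM mA; rewrite Yf// -integral_cst//.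
apply: ge0_le_integral => //.
- by move=> x _; rewrite lee_fin.
- by apply/measurable_EFinP; exact: measurable_funTS.
- by move=> x _; rewrite lee_fin (le_trans (ler_norm _)).
Qed.

(** The law of [(Y - x) / h] is dominated by [M h] times Lebesgue measure. This is the source of the
    factor [h] in the second moments, uniformly in [x]. *)
Lemma integral_kernel_le (Y : {RV P >-> R}) (f G : R -> R) (M x h : R) :
  has_density Y f -> (forall x, `|f x| <= M) -> 0 < h ->
  measurable_fun setT G -> (forall y, 0 <= G y) ->
  (\int[P]_w (G ((Y w - x) / h))%:E <= (M * h)%:E * \int[mu]_y (G y)%:E)%E.
Proof.
move=> Yf fM h0 mG G0.
have M0 : 0 <= M by apply: le_trans (fM 0).
have Mh0 : 0 <= M * h by rewrite mulr_ge0// ltW.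
pose phi w : R := (Y w - x) / h.
have mphi : measurable_fun setT phi.
  by apply: (measurableT_comp (measurable_affine x h)).
pose phim : {mfun T >-> measurableTypeR R} :=
  HB.pack phi (isMeasurableFun.Build _ _ T (measurableTypeR R) phi mphi).
pose m1 : {measure set (measurableTypeR R) -> \bar R} := distribution P phim.
pose m2 : {measure set (measurableTypeR R) -> \bar R} := mscale (NngNum Mh0) mu.
have mGE : measurable_fun setT (EFin \o G) by exact/measurable_EFinP.
have GE0 y : (0 <= (EFin \o G) y)%E by rewrite lee_fin.
have m12 (A : set (measurableTypeR R)) : measurable A -> (m1 A <= m2 A)%E.
  move=> mA; have -> : m2 A = (M%:E * (h%:E * mu A))%E by rewrite muleA -EFinM.
  rewrite -(lebesgue_measure_affine x h0)//.
  have := @distribution_density_le Y f M ((fun y => (y - x) / h) @^-1` A) Yf fM.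
  apply; rewrite -[X in measurable X]setTI; exact: measurable_affine.
have := ge0_le_measure_integral m12 (f := EFin \o G) measurableT GE0 mGE.
rewrite (@ge0_integral_mscale _ _ _ mu)//.
have -> : (\int[m1]_y (EFin \o G) y = \int[P]_w (EFin \o G \o phi) w)%E.
  exact: (ge0_integral_distribution phim mGE GE0).
by [].
Qed.

End density.

Lemma bigO_seq_le (R : realType) (a : nat -> \bar R) (b : nat -> R) (C : R) :
  (\forall n \near \oo, 0 < b n /\ (a n <= (C * b n)%:E)%E) -> bigO_seq a b.
Proof.
move=> abC; rewrite /bigO_seq; apply: (@le_lt_trans _ _ C%:E); last exact: ltry.
pose V := [set n | 0 < b n /\ (a n <= (C * b n)%:E)%E].
apply: ge_ereal_inf; exists (ereal_sup ((fun n => a n / (b n)%:E)%E @` V)).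
  by exists V.
apply: ge_ereal_sup => _ [n [bn anC] <-].
by rewrite inver gt_eqF// lee_pdivrMr// -EFinM.
Qed.

(** * The centered estimator as a block sum *)

Section kernel_estimator.
Context d (T : measurableType d) (R : realType) (P : probability T R).
Variable X : nat -> {RV P >-> R}.

Local Notation E Y := (fine 'E_P[Y]).

(** The sequence is [u i = rho (2 ^ i) ^ (2 / p)]; convergence of the series makes every term
    finite, which rules out an infinite [rho]. *)
Lemma rho_summable (p : R) : 2 <= p ->
  (\sum_(0 <= i <oo) (rho P X (2 ^ i)) `^ (2 / p) < +oo)%E ->
  exists (u : nat -> R) (W : R), [/\ (forall i, 0 <= u i),
    (forall n, \sum_(i < n) u i <= W) &
    (forall i, (rho P X (2 ^ i) <= (u i `^ (p / 2))%:E)%E)].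
Proof.
move=> p2 rhoy; pose U i := ((rho P X (2 ^ i)) `^ (2 / p))%E.
have p0 : 0 < p by exact: lt_le_trans p2.
have U0 i : (0 <= U i)%E by exact: poweR_ge0.
have Ule n : (\sum_(0 <= i < n) U i <= \sum_(0 <= i <oo) U i)%E.
  by apply: nneseries_lim_ge => i _ _; exact: U0.
have Ufin i : U i \is a fin_num.
  rewrite ge0_fin_numE//; apply: le_lt_trans rhoy.
  apply: le_trans (Ule i.+1); rewrite big_nat_recr//= leeDr// sume_ge0//.
exists (fun i => fine (U i)), (fine (\sum_(0 <= i <oo) U i)%E); split.
- by move=> i; exact: fine_ge0.
- move=> n; rewrite -lee_fin fineK; last first.
    by rewrite ge0_fin_numE// nneseries_ge0.
  apply: le_trans (Ule n); rewrite big_mkord -sumEFin.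
  by apply: lee_sum => i _; rewrite fineK.
- move=> i; have := Ufin i; rewrite /U; case: (rho P X (2 ^ i)) => [r||].
  + move=> _; rewrite lee_fin; have [r0|r0] := leP 0 r; last first.
      by rewrite (le_trans (ltW r0))// powR_ge0.
    rewrite -powRrM (_ : 2 / p * (p / 2) = 1) ?powRr1//.
    by field; rewrite gt_eqF.
  + by rewrite poweRyr// mulf_neq0// invr_eq0 gt_eqF.
  + by rewrite leNye.
Qed.

Variables (f K : R -> R) (Mf MK : R).
Hypothesis Xdens : forall i, (1 <= i)%N -> has_density (X i) f.
Hypothesis f_bnd : forall x, `|f x| <= Mf.
Hypothesis K_meas : measurable_fun setT K.
Hypothesis K_bnd : forall x, `|K x| <= MK.
Hypothesis K_int : (\int[lebesgue_measure]_x `|K x|%:E < +oo)%E.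

Definition centered_kernel (x h : R) i (y : R) : R :=
  K ((y - x) / h) - E (fun w => K ((X i w - x) / h)).

(** The first term comes from [K ^ 2 <= MK |K|] and the bound on the density. The added 1 makes the
    constant at least 1, so that [v = kernel_mass * h] is positive and [n v >= n h]. *)
Definition kernel_mass : R :=
  Mf * (MK * fine (\int[lebesgue_measure]_x `|K x|%:E)) + 1.

Lemma kernel_comp_bounded x h i :
  bounded_mfun (fun w => K ((X i w - x) / h)).
Proof.
split; last by exists MK.
apply: (measurableT_comp K_meas).
exact: (measurableT_comp (measurable_affine x h)).
Qed.

Lemma expect_kernel_sqr_le x h i : (1 <= i)%N -> 0 < h ->
  E (fun w => K ((X i w - x) / h) ^+ 2) <= kernel_mass * h.
Proof.
move=> i1 h0; have MK0 : 0 <= MK by apply: le_trans (K_bnd 0).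
have Mf0 : 0 <= Mf by apply: le_trans (f_bnd 0).
have I0 : (0 <= \int[lebesgue_measure]_x `|K x|%:E)%E.
  by apply: integral_ge0 => y _; rewrite lee_fin.
have Ifin : (\int[lebesgue_measure]_x `|K x|%:E)%E \is a fin_num.
  by rewrite ge0_fin_numE.
have bK2 := bounded_mfunX 2 (kernel_comp_bounded x h i).
rewrite -lee_fin fineK; last exact/expectation_fin_num/bounded_mfun_Lfun1.
rewrite unlock.
have mK2 : measurable_fun setT (fun y => K y ^+ 2) by exact: measurable_funX.
apply: (le_trans (integral_kernel_le x (Xdens i1) f_bnd h0 mK2 _)).
  by move=> y; exact: sqr_ge0.
have K2 : (\int[lebesgue_measure]_y (K y ^+ 2)%:E <=
    (MK * fine (\int[lebesgue_measure]_x `|K x|%:E))%:E)%E.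
  rewrite EFinM fineK// -ge0_integralZl_EFin//.
  - apply: ge0_le_integral => //.
    + by move=> y _; rewrite lee_fin sqr_ge0.
    + exact/measurable_EFinP.
    + apply: measurable_funeM; apply/measurable_EFinP; exact: measurableT_comp.
    + move=> y _; rewrite -EFinM lee_fin -real_normK ?num_real// expr2.
      by rewrite ler_wpM2r.
  - by apply/measurable_EFinP; exact: measurableT_comp.
apply: (@le_trans _ _ ((Mf * h)%:E *
    (MK * fine (\int[lebesgue_measure]_x `|K x|%:E))%:E)%E).
  by apply: lee_wpmul2l => //; rewrite lee_fin mulr_ge0// ltW.
rewrite -EFinM lee_fin /kernel_mass.
set J := fine _; nra.
Qed.

Lemma centered_kernel_bounded x h : bounded_fam (2 * MK) (centered_kernel x h).
Proof.
split=> [i|i y].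
  apply: measurable_funB => //.
  exact: (measurableT_comp K_meas (measurable_affine x h)).
have Kle : `|E (fun w => K ((X i w - x) / h))| <= MK.
  have bK := kernel_comp_bounded x h i.
  rewrite ler_norml; apply/andP; split.
  - rewrite -[leLHS](expect_cst P) expect_le//.
    by move=> w; have := K_bnd ((X i w - x) / h); rewrite ler_norml => /andP[].
  - rewrite -[leRHS](expect_cst P) expect_le//.
    by move=> w; have := K_bnd ((X i w - x) / h); rewrite ler_norml => /andP[].
rewrite (le_trans (ler_normB _ _))//.
have := K_bnd ((y - x) / h); lra.
Qed.

Lemma centered_kernel_centered x h : centered_fam X (centered_kernel x h).
Proof.
move=> i i1; rewrite expectD//; last exact: kernel_comp_bounded.
by rewrite expect_cst subrr.
Qed.

Lemma centered_kernel_sqr x h : 0 < h ->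
  sqr_bounded X (centered_kernel x h) (kernel_mass * h).
Proof.
move=> h0 i i1; apply: le_trans (expect_kernel_sqr_le x i1 h0).
have bK := kernel_comp_bounded x h i.
set c := E (fun w => K ((X i w - x) / h)).
rewrite (_ : (fun w => _) = fun w => K ((X i w - x) / h) ^+ 2 +
    ((- 2 * c) * K ((X i w - x) / h) + c ^+ 2)); last first.
  by apply/funext => w; rewrite /centered_kernel -/c; ring.
have bcK := bounded_mfunZ (- 2 * c) bK.
rewrite expectD; [|exact: bounded_mfunX|exact: bounded_mfunD].
rewrite expectD// expectZ// expect_cst -/c.
have := sqr_ge0 c; lra.
Qed.

Lemma kernel_est_centered h n x w :
  kernel_est X h K n x w - E (kernel_est X h K n x) =
  (n%:R * h n)^-1 * block_sum X (centered_kernel x (h n)) 1 n w.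
Proof.
pose c := \sum_(i < n) E (fun w => K ((X (1 + i)%N w - x) / h n)).
have kE : kernel_est X h K n x =
    fun w => (n%:R * h n)^-1 * (block_sum X (centered_kernel x (h n)) 1 n w + c).
  apply/funext => w'; rewrite /kernel_est; congr (_ * _).
  rewrite big_add1 big_mkord /block_sum /c -big_split; apply: eq_bigr => i _ /=.
  by rewrite /centered_kernel subrK.
have bb := bounded_mfun_block X 1 n (centered_kernel_bounded x (h n)).
rewrite kE expectZ; last exact: bounded_mfunD.
rewrite expectD// expect_cst (expect_block _ (centered_kernel_bounded x (h n))
  (centered_kernel_centered x (h n)))// add0r; ring.
Qed.

End kernel_estimator.

Lemma pow2_between n : (0 < n)%N -> exists N, (n <= 2 ^ N <= 2 * n)%N.
Proof.
move=> n0; have /andP[h1 h2] := trunc_log_bounds (ltnSn 1) n0.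
by exists (trunc_log 2 n).+1; rewrite ltnW// expnS leq_mul2l.
Qed.

Theorem theorem4p1 (d : measure_display) (T : measurableType d) (R : realType)
  (P : probability T R) (p : R) (X : nat -> {RV P >-> R})
  (f K : R -> R) (h : nat -> R)
  (hp : 2 <= p)
  (Xstat : stationary P X)
  (Xnondeg : forall i, (1 <= i)%N -> nondegenerate_rv P (X i))
  (Xmix : rho_mixing P X)
  (Xdens : forall i, (1 <= i)%N -> has_density (X i) f)
  (rho_sum : (\sum_(0 <= i <oo) (rho P X (2 ^ i)) `^ (2 / p) < +oo)%E)
  (h_gt0 : forall n, (1 <= n)%N -> 0 < h n)
  (h_dec : forall m n, (1 <= m)%N -> (m <= n)%N -> h n <= h m)
  (h_cvg0 : h n @[n --> \oo] --> 0)
  (nh_cvgy : n%:R * h n @[n --> \oo] --> +oo)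
  (f_bnd : exists M : R, forall x, `|f x| <= M)
  (K_meas : measurable_fun setT K)
  (K_bnd : exists M : R, forall x, `|K x| <= M)
  (K_int : (\int[lebesgue_measure]_x `|K x|%:E < +oo)%E) :
  bigO_seq
    (fun n => ereal_sup (range (fun x : R => Lnorm P p%:E
       (EFin \o (kernel_est X h K n x \- cst (fine 'E_P[kernel_est X h K n x]))))))
    (fun n => (1 / (n%:R * h n)) `^ 2^-1).
Proof.
have [Mf fM] := f_bnd; have [MK KM] := K_bnd.
have p0 : 0 < p by exact: lt_le_trans hp.
have [u [W [u0 uW rhou]]] := rho_summable hp rho_sum.
have MK0 : 0 <= MK by apply: le_trans (KM 0).
have Mf0 : 0 <= Mf by apply: le_trans (fM 0).
have M0 : 0 <= 2 * MK by rewrite mulr_ge0.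
have [D [D0 HD]] := rosenthal_rho M0 hp u0 uW rhou.
pose c := kernel_mass K Mf MK.
have c1 : 1 <= c.
  rewrite lerDr; apply: mulr_ge0 => //; apply: mulr_ge0 => //.
  by apply: fine_ge0; apply: integral_ge0.
have c0 : 0 < c by exact: lt_le_trans c1.
(* The [p]-th root of [2 D (2 c a) ^ (p / 2) a ^ - p], with [a = n h], is [C a ^ (- 1 / 2)]. *)
pose C := (2 * D) `^ p^-1 * (2 * c) `^ 2^-1.
apply: (@bigO_seq_le _ _ _ C).
have nh1 := (cvgryPge _).1 nh_cvgy 1.
near=> n.
have n0 : (0 < n)%N by near: n; exact: nbhs_infty_gt.
have a1 : 1 <= n%:R * h n by near: n; exact: nh1.
have hn0 : 0 < h n by exact: h_gt0.
set a := n%:R * h n in a1 *.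
have a0 : 0 < a by exact: lt_le_trans a1.
have b0 : 0 < (1 / a) `^ 2^-1 by rewrite powR_gt0// divr_gt0.
split => //; apply: ge_ereal_sup => _ [x _ <-].
pose B w := block_sum X (centered_kernel X K x (h n)) 1 n w.
have bfam := centered_kernel_bounded X K_meas KM x (h n).
have bB : bounded_mfun B by exact: bounded_mfun_block bfam.
have bBp := bounded_mfun_powR (ltW p0) bB.
have [N /andP[nN Nn]] := pow2_between n0.
(* With [n <= 2 ^ N <= 2 n], the quantity [s] satisfies [1 <= a <= s <= 2 c a]; the linear term of
   Rosenthal's bound is then absorbed by [s ^ (p / 2)], as [p / 2 >= 1]. *)
have EB : fine 'E_P[fun w => `|B w| `^ p] <= 2 * D * (2 * c * a) `^ (p / 2).
  have := HD _ (c * h n) bfam (centered_kernel_centered X K_meas KM x (h n))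
    (centered_kernel_sqr Xdens fM K_meas KM K_int x hn0) (mulr_gt0 c0 hn0)
    N 1%N n (leqnn _) nN.
  set s := 2 ^+ N * (c * h n).
  have as_ : a <= s.
    apply: (@le_trans _ _ (2 ^+ N * h n)).
      by apply: ler_wpM2r; [exact: ltW|rewrite -natrX ler_nat].
    by apply: ler_wpM2l; [exact: exprn_ge0|apply: ler_peMl => //; exact: ltW].
  have sa : s <= 2 * c * a.
    have -> : 2 * c * a = (2 * n)%:R * (c * h n) by rewrite /a natrM; ring.
    by apply: ler_wpM2r; [apply: mulr_ge0; exact: ltW|rewrite -natrX ler_nat].
  have s1 : 1 <= s by exact: le_trans as_.
  have ss : s <= s `^ (p / 2) by rewrite le1r_powR// ler_pdivlMr// mul1r.
  have sp : s `^ (p / 2) <= (2 * c * a) `^ (p / 2).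
    have s0 : 0 <= s by exact: le_trans s1.
    apply: ge0_ler_powR; rewrite ?nnegrE ?divr_ge0 ?(ltW p0)//.
    exact: le_trans sa.
  move=> /le_trans; apply.
  have -> : 2 * D * (2 * c * a) `^ (p / 2) =
      D * ((2 * c * a) `^ (p / 2) + (2 * c * a) `^ (p / 2)) by ring.
  by rewrite ler_wpM2l// lerD// (le_trans ss).
rewrite unlock.
have -> : (\int[P]_w `|(EFin \o (kernel_est X h K n x \-
    cst (fine 'E_P[kernel_est X h K n x]))%R) w| `^ p =
    (a^-1 `^ p * fine 'E_P[fun w => `|B w| `^ p])%:E)%E.
  rewrite -(expectZ P _ bBp) fineK; last first.
    exact/expectation_fin_num/bounded_mfun_Lfun1/bounded_mfunZ.
  rewrite [in RHS]unlock; apply: eq_integral => w _ /=.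
  rewrite (kernel_est_centered X K_meas KM) -/a -/(B w) normrM gtr0_norm ?invr_gt0//.
  by rewrite powRM// invr_ge0 ltW.
rewrite poweR_EFin lee_fin.
have Cb0 : 0 <= C * (1 / a) `^ 2^-1 by rewrite !mulr_ge0 ?powR_ge0.
(* Writing the right side as a [p]-th root reduces the claim to a comparison of [p]-th powers. *)
have <- : ((C * (1 / a) `^ 2^-1) `^ p) `^ p^-1 = C * (1 / a) `^ 2^-1.
  by rewrite -powRrM divff ?gt_eqF// powRr1.
rewrite ge0_ler_powR ?nnegrE ?invr_ge0 ?(ltW p0) ?powR_ge0//.
  apply: mulr_ge0; first exact: powR_ge0.
  by apply: expect_ge0 => w; exact: powR_ge0.
apply: (@le_trans _ _ (a^-1 `^ p * (2 * D * (2 * c * a) `^ (p / 2)))).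
  by rewrite ler_wpM2l ?powR_ge0.
have -> : (C * (1 / a) `^ 2^-1) `^ p =
    2 * D * (2 * c) `^ (p / 2) * a^-1 `^ (p / 2).
  have pow3 (x1 x2 x3 : R) : 0 <= x1 ->
      (x1 `^ p^-1 * x2 `^ 2^-1 * x3 `^ 2^-1) `^ p =
      x1 * x2 `^ (p / 2) * x3 `^ (p / 2).
    move=> x10; rewrite powRM ?mulr_ge0 ?powR_ge0// powRM ?powR_ge0// -!powRrM.
    by rewrite mulVf ?gt_eqF// powRr1// [2^-1 * p]mulrC.
  by rewrite pow3 ?mulr_ge0// div1r.
have cc0 : 0 <= 2 * c by rewrite mulr_ge0// ltW.
rewrite (powRM _ cc0 (ltW a0)).
have -> : a^-1 `^ p = a^-1 `^ (p / 2) * a^-1 `^ (p / 2).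
  have aV0 : a^-1 != 0 by rewrite gt_eqF// invr_gt0.
  rewrite -powRD ?aV0 ?implybT//; congr (_ `^ _); by field.
have : a^-1 `^ (p / 2) * a `^ (p / 2) = 1.
  by rewrite -powRM ?invr_ge0 ?(ltW a0)// mulVf ?gt_eqF// powR1.
move: (a^-1 `^ (p / 2)) (a `^ (p / 2)) => y z yz.
rewrite le_eqVlt; apply/orP; left; apply/eqP.
by rewrite -[RHS]mulr1 -yz; ring.
Unshelve. all: by end_near. Qed.
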